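(* For every $0<\alpha<1$ there exists a solution $u^{\alpha}(t,x)$ of $$iu_t(t,x)+u_{xx}(t,x)+u^2(t,x)\,\overline{u}(t,-x)=0,$$ defined on $[0,T_\alpha)\times\mathbb{R}$ where $T_\alpha=\dfrac{\pi}{3\alpha^2}$, such that the family $(u^\alpha)_{0<\alpha<1}$ has the following properties: (i) for every $\alpha\in(0,1)$, $u^{\alpha}$ blows up in $L^\infty(\mathbb{R})$ as $t\to T_\alpha$, with $\lim_{t\to T_\alpha^-}|u^{\alpha}(t,0)|=\infty$; (ii) for every $k\in\mathbb{N}$ there is a constant $C_k>0$, independent of $\alpha$, such that the initial data $u_0^\alpha=u^\alpha(0,\cdot)$ satisfies $\|u^{\alpha}_0\|_{H^k(\mathbb{R})}\le C_k\,\alpha^{1/2}$ for all $\alpha\in(0,1)$.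
   Context: Functions are complex-valued, and $\overline{u}(t,-x)$ denotes the complex conjugate of $u(t,-x)$. Let $S(t)=e^{it\partial_x^2}$ be the free Schrödinger group on $\mathbb{R}$ and $F(u)(x)=u^2(x)\overline{u}(-x)$. A solution on $[0,T)\times\mathbb{R}$ is a function $u\in C([0,T),H^1(\mathbb{R}))$ satisfying $$u(t)=S(t)u(0)+i\int_0^t S(t-s)F(u(s))\,ds,\qquad t\in[0,T)$$ (equivalently, the equation holds in $H^{-1}(\mathbb{R})$). $H^k(\mathbb{R})$ is the usual $L^2$-based Sobolev space. ''Blows up in $L^\infty(\mathbb{R})$ as $t\to T_\alpha$'' means $\|u^\alpha(t,\cdot)\|_{L^\infty(\mathbb{R})}\to\infty$ as $t\to T_\alpha^-$. *)

(* Defs.v *)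
From HB Require Import structures.
From mathcomp Require Import all_boot all_order all_algebra.
From mathcomp Require Import all_classical all_reals all_analysis.
From mathcomp Require Import complex.

Set Implicit Arguments.
Unset Strict Implicit.
Unset Printing Implicit Defensive.

Import Order.TTheory GRing.Theory Num.Theory.
Import numFieldNormedType.Exports.

Local Open Scope classical_set_scope.
Local Open Scope ring_scope.

Section NonlocalNLS.
Context {R : realType}.
Local Notation C := R[i].
Local Notation mu := (@lebesgue_measure R).
Implicit Types (f g fh : R -> C) (phi : R -> R) (t T a b : R) (k : nat).

Definition cis (x : R) : C := (cos x +i* sin x)%C.

Definition cmeasurable f : Prop :=
  measurable_fun setT (fun x => complex.Re (f x)) /\
  measurable_fun setT (fun x => complex.Im (f x)).

Definition ccontinuous f : Prop :=
  continuous (fun x => complex.Re (f x)) /\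
  continuous (fun x => complex.Im (f x)).

Definition cintegral (D : set R) f : C :=
  ((\int[mu]_(x in D) complex.Re (f x))
   +i* (\int[mu]_(x in D) complex.Im (f x)))%C.

Definition cLnorm (p : \bar R) f : \bar R :=
  Lnorm mu p (fun x => (Normc.normc (f x))%:E).

Definition inL2 f : Prop := cmeasurable f /\ (cLnorm 2%:E f < +oo)%E.

(* [C^oo] with compact support; it is enough to test against real functions. *)
Definition test_function phi : Prop :=
  (forall n x, derivable (derive1n n phi) x 1) /\
  exists M : R, forall x, M < `|x| -> phi x = 0.

Definition weak_derivative f g : Prop :=
  forall phi, test_function phi ->
    cintegral setT (fun x => f x * (derive1 phi x)%:C%C)
    = - cintegral setT (fun x => g x * (phi x)%:C%C).

(* [D 0, ..., D k] are [f] and its first [k] weak derivatives, all in [L^2]. *)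
Definition weak_jet k f (D : nat -> R -> C) : Prop :=
  [/\ D 0%N = f,
      forall j, (j <= k)%N -> inL2 (D j) &
      forall j, (j < k)%N -> weak_derivative (D j) (D j.+1)].

(* The norm of [H^k]. Weak derivatives are unique almost everywhere, so the set
   below has at most one element; it is empty, and the infimum is [+oo],
   exactly when [f] is not in [H^k]. *)
Definition Hnorm k f : \bar R :=
  ereal_inf [set ((\sum_(j < k.+1) cLnorm 2%:E (D j) ^+ 2) `^ (2^-1))%E
            | D in weak_jet k f].

Definition inH k f : Prop := exists D, weak_jet k f D.

Definition truncated_fourier (n : nat) f : R -> C := fun xi =>
  cintegral [set` `[- n%:R, n%:R]] (fun x => cis (- (x * xi)) * f x).

(* Fourier transform on [L^2]: the [L^2]-limit of the truncated integrals. *)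
Definition is_fourier f fh : Prop :=
  [/\ inL2 f, inL2 fh &
      cLnorm 2%:E (truncated_fourier n f \- fh) @[n --> \oo] --> 0%E].

(* [g = S(t) f], where [S(t) = e^{i t d_x^2}] is the Fourier multiplier of
   symbol [e^{- i t xi^2}] on [L^2]. *)
Definition is_schrodinger t f g : Prop :=
  exists fh, is_fourier f fh /\
    is_fourier g (fun xi => cis (- (t * xi ^+ 2)) * fh xi).

(* [V = \int_a^b W(s) ds] as a Riemann integral with values in [L^2], for
   [a <= b]: Riemann sums over tagged subdivisions [a = x 0 <= ... <= x n = b]
   with tags [c i] converge to [V] in [L^2] as the mesh tends to [0]. *)
Definition is_integral_L2 a b (W : R -> R -> C) (V : R -> C) : Prop :=
  [/\ forall s, a <= s <= b -> inL2 (W s), inL2 V &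
      forall eps : R, 0 < eps -> exists2 delta : R, 0 < delta &
        forall (n : nat) (x c : nat -> R), x 0%N = a -> x n = b ->
          (forall i, (i < n)%N ->
             [/\ x i <= c i, c i <= x i.+1 & x i.+1 - x i < delta]) ->
          (cLnorm 2%:E
             (fun y => \sum_(i < n) (x i.+1 - x i)%:C%C * W (c i) y - V y)%R
           < eps%:E)%E].

Definition nonlocal_cubic f : R -> C := fun x => f x ^+ 2 * (f (- x))^*%C.

(* [u(t) = S(t) u(0) + i \int_0^t S(t-s) F(u(s)) ds], an equality in [L^2]. *)
Definition duhamel (u : R -> R -> C) t : Prop :=
  exists (A : R -> C) (W : R -> R -> C) (V : R -> C),
    [/\ is_schrodinger t (u 0) A,
        forall s, 0 <= s <= t ->
          is_schrodinger (t - s) (nonlocal_cubic (u s)) (W s),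
        is_integral_L2 0 t W V &
        {ae mu, forall x, u t x = A x + 'i%C * V x}].

(* [u] in [C([0,T), H^1)] satisfying Duhamel's formula. Every [u t] is taken to
   be the continuous representative of its class, so that the values [u t x]
   at a point are meaningful. Values at times outside [0,T) are irrelevant. *)
Definition is_solution T (u : R -> R -> C) : Prop :=
  [/\ forall t, 0 <= t < T -> inH 1 (u t) /\ ccontinuous (u t),
      forall t, 0 <= t < T ->
        Hnorm 1 (u s \- u t)
          @[s --> within [set` `[0, T[] (nbhs t)] --> 0%E &
      forall t, 0 <= t < T -> duhamel u t].

End NonlocalNLS.

(* Main.v *)
Require Import Defs.
From HB Require Import structures.
From mathcomp Require Import all_boot all_order all_algebra.
From mathcomp Require Import all_classical all_reals all_analysis.
From mathcomp Require Import complex.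
From mathcomp Require Import measurable_realfun zify ring lra.

Set Implicit Arguments.
Unset Strict Implicit.
Unset Printing Implicit Defensive.

Import Order.TTheory GRing.Theory Num.Theory.
Import numFieldNormedType.Exports.

Local Open Scope classical_set_scope.
Local Open Scope ring_scope.

(* The solution is explicit: a soliton of the focusing cubic NLS whose two decay
   rates are [alpha] and [2 alpha],
     u(t,x) = 3 sqrt 2 alpha e^{alpha x + i alpha^2 t} / (1 + e^{3 alpha x - 3 i alpha^2 t}).
   Its conjugate reflected in [x] is the partner function of the soliton, so it
   solves the nonlocal equation; the denominator first vanishes at [x = 0],
   [3 alpha^2 t = pi], and at [t = 0] scaling gives the bound [alpha^{1/2}].
   Before the blow-up, [u] and its derivatives are spanned by the functions
   t^n x^m e^{i k t} e^{j alpha x} / (1 + e^{3 alpha x - 3 i alpha^2 t})^p, 0 < j < 3 p,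
   which form a class stable under [x], [d/dx] and [d/dt]. The Fourier transform
   preserves such classes, and w(s) = S(t-s) u(s) satisfies dw/ds = i S(t-s) F(u(s))
   pointwise, so that Duhamel's formula is the fundamental theorem of calculus. *)

(** * Complex-valued functions of a real variable *)

(** The two rates must differ: for rates a and b the exponential in the denominator rotates with
    speed b^2 - a^2, which is 3 alpha^2 here and would be 0 for a = b.

    The obstacle is that the statement asks for an L^2 theory: transforms are limits of truncated
    integrals, S(t) is a multiplier, the Duhamel integral is a limit of Riemann sums. Each such
    claim is reduced to a pointwise bound by a multiple of 1/(1+x^2), which is integrable, at most
    1, and has explicit tails. Inversion is proved directly, by averaging against Gaussians.

    The condition 0 < j < 3p says that e^{j alpha x} / (1 + e^{3 alpha x})^p decays exponentially at
    both ends. It survives differentiation, which keeps (j, p) or sends it to (j+3, p+1). The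
    factors t^n x^m are there for the Fourier side: differentiating a transform in xi multiplies the
    function by x, and differentiating a phase (p s + q) xi^2 in xi brings down a factor affine in
    s. *)

Section ComplexCalculus.
Context {R : realType}.
Local Notation C := R[i].
Local Notation normc := Normc.normc.
Implicit Types (f g : R -> C) (x : R).

Lemma Re_le_normc (z : C) : `|complex.Re z| <= normc z.
Proof.
by case: z => a b /=; rewrite -sqrtr_sqr ler_wsqrtr// lerDl sqr_ge0.
Qed.

Lemma Im_le_normc (z : C) : `|complex.Im z| <= normc z.
Proof.
by case: z => a b /=; rewrite -sqrtr_sqr ler_wsqrtr// lerDr sqr_ge0.
Qed.

Lemma normc_ge0 (z : C) : 0 <= normc z.
Proof. by case: z => a b; exact: sqrtr_ge0. Qed.

Lemma normc_real (r : R) : normc r%:C%C = `|r|.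
Proof. by rewrite /= expr0n addr0 sqrtr_sqr. Qed.

Lemma normc_le (z : C) : normc z <= `|complex.Re z| + `|complex.Im z|.
Proof.
case: z => a b /=; rewrite -[leRHS]ger0_norm ?addr_ge0// -sqrtr_sqr.
rewrite ler_wsqrtr// sqrrD !real_normK ?num_real//.
by rewrite -addrA (addrC (_ *+ 2)) addrA lerDl mulrn_wge0// mulr_ge0.
Qed.

Lemma normc_sqr (z : C) : normc z ^+ 2 = complex.Re z ^+ 2 + complex.Im z ^+ 2.
Proof. by case: z => a b /=; rewrite sqr_sqrtr// addr_ge0 ?sqr_ge0. Qed.

Lemma normc_sub_le (z w : C) : normc (z - w) <= normc z + normc w.
Proof. by rewrite (le_trans (le_normcD _ _))// normcN. Qed.

Lemma normcX (z : C) n : normc (z ^+ n) = normc z ^+ n.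
Proof.
by elim: n => [|n IH]; rewrite ?expr0 ?Normc.normc1// !exprS Normc.normcM IH.
Qed.

Lemma normc_i : normc ('i%C : C) = 1.
Proof. by rewrite /= expr0n/= add0r expr1n sqrtr1. Qed.

Lemma normc_cis x : normc (cis x) = 1.
Proof. by rewrite /= cos2Dsin2 sqrtr1. Qed.

Lemma cisD x y : cis (x + y) = cis x * cis y.
Proof.
rewrite /cis cosD sinD; apply/eqP; rewrite eq_complex/=.
by apply/andP; split; apply/eqP; ring.
Qed.

Lemma cis0 : cis 0 = 1 :> C.
Proof. by rewrite /cis cos0 sin0. Qed.

Lemma cisN_cis x : cis (- x) * cis x = 1 :> C.
Proof. by rewrite -cisD addNr cis0. Qed.

Lemma cis_neq0 x : cis x != 0 :> C.
Proof.
apply/eqP => cx0; have := normc_cis x.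
by rewrite cx0 Normc.normc0 => /eqP; rewrite eq_sym oner_eq0.
Qed.

Lemma conj_cis x : (cis x)^*%C = cis (- x).
Proof. by rewrite /cis cosN sinN. Qed.

(** Componentwise, like [ccontinuous] and [cintegral], so that the real mean value theorem,
    fundamental theorem of calculus and Leibniz rule apply to each component. *)
Definition cder f x (l : C) : Prop :=
  is_derive x 1 (fun y => complex.Re (f y)) (complex.Re l) /\
  is_derive x 1 (fun y => complex.Im (f y)) (complex.Im l).

Lemma cder_eq f x l l' : cder f x l -> l = l' -> cder f x l'.
Proof. by move=> ? <-. Qed.

Lemma cder_cst (c : C) x : cder (cst c) x 0.
Proof. by split; exact: is_derive_cst. Qed.

Lemma Re_add (z w : C) : complex.Re (z + w) = complex.Re z + complex.Re w.
Proof. by case: z w => [a b] [c d]. Qed.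

Lemma Im_add (z w : C) : complex.Im (z + w) = complex.Im z + complex.Im w.
Proof. by case: z w => [a b] [c d]. Qed.

Lemma Re_opp (z : C) : complex.Re (- z) = - complex.Re z.
Proof. by case: z. Qed.

Lemma Im_opp (z : C) : complex.Im (- z) = - complex.Im z.
Proof. by case: z. Qed.

Lemma Re_mul (z w : C) : complex.Re (z * w) =
  complex.Re z * complex.Re w - complex.Im z * complex.Im w.
Proof. by case: z w => [a b] [c d]. Qed.

Lemma Im_mul (z w : C) : complex.Im (z * w) =
  complex.Re z * complex.Im w + complex.Im z * complex.Re w.
Proof. by case: z w => [a b] [c d]. Qed.

Lemma cderD f g x k l : cder f x k -> cder g x l ->
  cder (fun y => f y + g y) x (k + l).
Proof.
move=> [f1 f2] [g1 g2]; split.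
  under eq_fun do rewrite Re_add.
  by rewrite Re_add; exact: is_deriveD.
under eq_fun do rewrite Im_add.
by rewrite Im_add; exact: is_deriveD.
Qed.

Lemma cderM f g x k l : cder f x k -> cder g x l ->
  cder (fun y => f y * g y) x (k * g x + f x * l).
Proof.
move=> [f1 f2] [g1 g2]; split.
  rewrite (_ : (fun y => _) =
    (fun y => complex.Re (f y)) * (fun y => complex.Re (g y)) -
    (fun y => complex.Im (f y)) * (fun y => complex.Im (g y))); last first.
    by apply/funext => y /=; rewrite Re_mul.
  apply: is_derive_eq (is_deriveB (is_deriveM f1 g1) (is_deriveM f2 g2)) _.
  by rewrite Re_add !Re_mul /GRing.scale/=; ring.
rewrite (_ : (fun y => _) =
  (fun y => complex.Re (f y)) * (fun y => complex.Im (g y)) +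
  (fun y => complex.Im (f y)) * (fun y => complex.Re (g y))); last first.
  by apply/funext => y /=; rewrite Im_mul.
apply: is_derive_eq (is_deriveD (is_deriveM f1 g2) (is_deriveM f2 g1)) _.
by rewrite Im_add !Im_mul /GRing.scale/=; ring.
Qed.

Lemma cderZ f x l (c : C) : cder f x l -> cder (fun y => c * f y) x (c * l).
Proof.
move=> fl; apply: cder_eq (cderM (cder_cst c x) fl) _.
by rewrite mul0r add0r.
Qed.

Lemma cderX f x l n : cder f x l ->
  cder (fun y => f y ^+ n) x (n%:R * f x ^+ n.-1 * l).
Proof.
move=> fl; elim: n => [|n IH].
  by rewrite mul0r mul0r; under eq_fun do rewrite expr0; exact: cder_cst.
under eq_fun do rewrite exprS.
apply: cder_eq (cderM fl IH) _.
case: n {IH} => [|n] /=; first by rewrite expr0 mulr1 mul0r mul0r mulr0 addr0 !mul1r.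
by rewrite !mulrSr !exprS; ring.
Qed.

Lemma Re_inv (z : C) : complex.Re z^-1 =
  complex.Re z / (complex.Re z ^+ 2 + complex.Im z ^+ 2).
Proof. by case: z. Qed.

Lemma Im_inv (z : C) : complex.Im z^-1 =
  - (complex.Im z / (complex.Re z ^+ 2 + complex.Im z ^+ 2)).
Proof. by case: z. Qed.

Lemma normc_sqr_neq0 (z : C) : z != 0 ->
  complex.Re z ^+ 2 + complex.Im z ^+ 2 != 0.
Proof.
by case: z => a b; rewrite eq_complex/= paddr_eq0 ?sqr_ge0// !sqrf_eq0.
Qed.

Lemma cderV f x l : f x != 0 -> cder f x l ->
  cder (fun y => (f y)^-1) x (- l / f x ^+ 2).
Proof.
move=> /normc_sqr_neq0 N0 [f1 f2].
pose N := (fun y => complex.Re (f y)) * (fun y => complex.Re (f y)) +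
  (fun y => complex.Im (f y)) * (fun y => complex.Im (f y)).
have {}N0 : N x != 0 by [].
have dN : is_derive x 1 N
    (2 * (complex.Re (f x) * complex.Re l + complex.Im (f x) * complex.Im l)).
  apply: is_derive_eq (is_deriveD (is_deriveM f1 f1) (is_deriveM f2 f2)) _.
  by rewrite /GRing.scale/=; ring.
have dNV : is_derive x 1 (fun y => (N y)^-1) (- (N x) ^- 2 *
    (2 * (complex.Re (f x) * complex.Re l + complex.Im (f x) * complex.Im l))).
  exact: is_deriveV.
have E : - l / f x ^+ 2 = - (l * ((f x)^-1 * (f x)^-1)).
  by rewrite -expr2 exprVn mulNr.
rewrite E; split.
  rewrite (_ : (fun y => _) = (fun y => complex.Re (f y)) * (fun y => (N y)^-1)); last first.
    by apply/funext => y; rewrite Re_inv.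
  apply: is_derive_eq.
  rewrite Re_opp !Re_mul Im_mul !Re_inv !Im_inv /GRing.scale/=.
  have : N x = complex.Re (f x) ^+ 2 + complex.Im (f x) ^+ 2 by [].
  by move: (N x) N0 => n n0 nE; rewrite -nE; field: nE.
rewrite (_ : (fun y => _) = - ((fun y => complex.Im (f y)) * (fun y => (N y)^-1))); last first.
  by apply/funext => y; rewrite Im_inv.
apply: is_derive_eq.
rewrite Im_opp !Im_mul Re_mul !Re_inv !Im_inv /GRing.scale/=.
have : N x = complex.Re (f x) ^+ 2 + complex.Im (f x) ^+ 2 by [].
by move: (N x) N0 => n n0 nE; rewrite -nE; field: nE.
Qed.

Lemma cder_cis (r : R -> R) x l : is_derive x 1 r l ->
  cder (fun y => cis (r y)) x (l%:C%C * 'i%C * cis (r x)).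
Proof.
move=> rl; split => /=.
  have := is_derive1_comp (is_derive_cos (r x)) rl.
  by rewrite (_ : cos \o r = (fun y => cos (r y)))// => h; apply: is_derive_eq h _; ring.
have := is_derive1_comp (is_derive_sin (r x)) rl.
by rewrite (_ : sin \o r = (fun y => sin (r y)))// => h; apply: is_derive_eq h _; ring.
Qed.

Lemma cder_real (r : R -> R) x l : is_derive x 1 r l ->
  cder (fun y => (r y)%:C%C) x l%:C%C.
Proof. by move=> rl; split => //=; exact: is_derive_cst. Qed.

Lemma cder_continuous f l : (forall x, cder f x (l x)) -> ccontinuous f.
Proof.
move=> fl; split => x; have [d1 d2] := fl x.
  by apply: differentiable_continuous; apply/derivable1_diffP; exact: ex_derive.
by apply: differentiable_continuous; apply/derivable1_diffP; exact: ex_derive.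
Qed.

Lemma near_eq_cder f g x l : (\forall y \near x, f y = g y) ->
  cder f x l -> cder g x l.
Proof.
move=> fg [f1 f2]; split.
  apply: near_eq_is_derive f1.
  by apply: filterS fg => y ->.
apply: near_eq_is_derive f2.
by apply: filterS fg => y ->.
Qed.

End ComplexCalculus.

(** * Componentwise integration of complex-valued functions *)

Section ComplexIntegral.
Context {R : realType}.
Local Notation C := R[i].
Local Notation normc := Normc.normc.
Local Notation mu := (@lebesgue_measure R).
Implicit Types (f g : R -> C) (x : R).

Definition cintegrable (D : set R) f : Prop :=
  mu.-integrable D (EFin \o (fun x => complex.Re (f x))) /\
  mu.-integrable D (EFin \o (fun x => complex.Im (f x))).

Lemma eq_cintegral (D : set R) f g : (forall x, D x -> f x = g x) ->
  cintegral D f = cintegral D g.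
Proof.
by move=> fg; rewrite /cintegral; congr (_ +i* _)%C;
  apply: eq_Rintegral => x /set_mem/fg ->.
Qed.

Lemma cintegralD (D : set R) f g : measurable D ->
  cintegrable D f -> cintegrable D g ->
  cintegral D (fun x => f x + g x) = cintegral D f + cintegral D g.
Proof.
move=> mD [f1 f2] [g1 g2]; rewrite /cintegral.
under eq_Rintegral do rewrite Re_add.
under [X in (_ +i* X)%C]eq_Rintegral do rewrite Im_add.
by rewrite !RintegralD.
Qed.

Let integrable_lin (D : set R) (a b : R) (p q : R -> R) : measurable D ->
  mu.-integrable D (EFin \o p) -> mu.-integrable D (EFin \o q) ->
  mu.-integrable D (EFin \o (fun x => a * p x + b * q x)).
Proof.
move=> mD ip iq.
rewrite (_ : _ \o _ = (fun x => a%:E * (p x)%:E) \+ (fun x => b%:E * (q x)%:E))%E//.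
by apply: integrableD => //; apply: integrableZl.
Qed.

Lemma cintegrableZ (D : set R) (c : C) f : measurable D ->
  cintegrable D f -> cintegrable D (fun x => c * f x).
Proof.
move=> mD [f1 f2]; split.
  under [X in EFin \o X]eq_fun do rewrite Re_mul -mulNr.
  exact: integrable_lin.
under [X in EFin \o X]eq_fun do rewrite Im_mul addrC.
exact: integrable_lin.
Qed.

Let RintegralZ2 (D : set R) (a b : R) (p q : R -> R) : measurable D ->
  mu.-integrable D (EFin \o p) -> mu.-integrable D (EFin \o q) ->
  \int[mu]_(x in D) (a * p x + b * q x) =
  a * \int[mu]_(x in D) p x + b * \int[mu]_(x in D) q x.
Proof.
move=> mD ip iq; rewrite RintegralD ?RintegralZl//.
  have := integrable_lin a 0 mD ip ip.
  by congr (_.-integrable _ _); apply/funext => x /=; rewrite mul0r addr0.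
have := integrable_lin b 0 mD iq iq.
by congr (_.-integrable _ _); apply/funext => x /=; rewrite mul0r addr0.
Qed.

Lemma cintegralZ (D : set R) (c : C) f : measurable D -> cintegrable D f ->
  cintegral D (fun x => c * f x) = c * cintegral D f.
Proof.
move=> mD [f1 f2]; rewrite /cintegral.
rewrite [X in (X +i* _)%C](_ : _ = complex.Re c * \int[mu]_(x in D) complex.Re (f x)
   + (- complex.Im c) * \int[mu]_(x in D) complex.Im (f x)); last first.
  by rewrite -RintegralZ2//; apply: eq_Rintegral => x _; rewrite Re_mul mulNr.
rewrite [X in (_ +i* X)%C](_ : _ = complex.Im c * \int[mu]_(x in D) complex.Re (f x)
   + complex.Re c * \int[mu]_(x in D) complex.Im (f x)); last first.
  by rewrite -RintegralZ2//; apply: eq_Rintegral => x _; rewrite Im_mul addrC.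
apply/eqP; rewrite eq_complex Re_mul Im_mul /= mulNr eqxx/=.
by rewrite addrC.
Qed.

Lemma cintegrableS (A B : set R) f : measurable A -> measurable B -> A `<=` B ->
  cintegrable B f -> cintegrable A f.
Proof. by move=> mA mB AB [f1 f2]; split; [exact: integrableS f1|exact: integrableS f2]. Qed.

(** The factor 2 comes from bounding the real and the imaginary part separately. *)
Lemma normc_cintegral_le (D : set R) f (g : R -> R) : measurable D ->
  cintegrable D f -> mu.-integrable D (EFin \o g) ->
  (forall x, D x -> normc (f x) <= g x) ->
  normc (cintegral D f) <= 2 * \int[mu]_(x in D) g x.
Proof.
move=> mD [f1 f2] ig fg; apply: le_trans (normc_le _) _.
rewrite mulr_natl mulr2n /cintegral; apply: lerD => /=.
  apply: le_trans; first exact: le_normr_Rintegral.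
  apply: le_Rintegral => //; first exact: integrable_norm f1.
  by move=> x /fg; exact/le_trans/Re_le_normc.
apply: le_trans; first exact: le_normr_Rintegral.
apply: le_Rintegral => //; first exact: integrable_norm f2.
by move=> x /fg; exact/le_trans/Im_le_normc.
Qed.

Lemma ccontinuous_measurable f : ccontinuous f -> cmeasurable f.
Proof. by move=> [f1 f2]; split; exact: continuous_measurable_fun. Qed.

Lemma cmeasurableD f g : cmeasurable f -> cmeasurable g ->
  cmeasurable (fun x => f x + g x).
Proof.
move=> [f1 f2] [g1 g2]; split.
  by under eq_fun do rewrite Re_add; exact: measurable_funD.
by under eq_fun do rewrite Im_add; exact: measurable_funD.
Qed.

Lemma cmeasurableM f g : cmeasurable f -> cmeasurable g ->
  cmeasurable (fun x => f x * g x).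
Proof.
move=> [f1 f2] [g1 g2]; split.
  under eq_fun do rewrite Re_mul.
  by apply: measurable_funB; apply: measurable_funM.
under eq_fun do rewrite Im_mul.
by apply: measurable_funD; apply: measurable_funM.
Qed.

Lemma cmeasurableZ (c : C) f : cmeasurable f -> cmeasurable (fun x => c * f x).
Proof.
by apply: cmeasurableM; split; exact: measurable_cst.
Qed.

Lemma cmeasurable_sum n (F : nat -> R -> C) :
  (forall i, (i < n)%N -> cmeasurable (F i)) ->
  cmeasurable (fun x => \sum_(i < n) F i x).
Proof.
elim: n => [|n IH] mF.
  under eq_fun do rewrite big_ord0.
  by split; exact: measurable_cst.
under eq_fun do rewrite big_ord_recr/=.
apply: cmeasurableD; last exact: mF.
by apply: IH => i /ltnW; exact: mF.
Qed.

Lemma dominated_cintegrable (D : set R) f (g : R -> R) : measurable D ->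
  cmeasurable f -> mu.-integrable D (EFin \o g) ->
  (forall x, D x -> normc (f x) <= g x) -> cintegrable D f.
Proof.
move=> mD [f1 f2] ig fg; split; apply: le_integrable ig => //=.
- by apply/measurable_EFinP; exact: measurable_funTS.
- move=> x /fg h; rewrite lee_fin (le_trans (Re_le_normc _))//.
  by rewrite (le_trans h)// ler_norm.
- by apply/measurable_EFinP; exact: measurable_funTS.
- move=> x /fg h; rewrite lee_fin (le_trans (Im_le_normc _))//.
  by rewrite (le_trans h)// ler_norm.
Qed.

Lemma cintegral_setC (D : set R) f : measurable D -> cintegrable setT f ->
  cintegral setT f = cintegral D f + cintegral (~` D) f.
Proof.
move=> mD [f1 f2]; rewrite /cintegral -(setUv D) !Rintegral_setU//.
all: try exact: measurableC.
all: rewrite ?setUv//.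
all: by apply/disj_setPS => x [? []].
Qed.

Lemma continuous_FTC (f F : R -> R) a b : a <= b -> continuous f ->
  (forall x, is_derive x 1 F (f x)) ->
  \int[mu]_(x in `[a, b]) f x = F b - F a.
Proof.
rewrite le_eqVlt => /predU1P[-> _ _|ab cf dF].
  by rewrite set_itv1 Rintegral_set1 subrr.
have cF : continuous F.
  move=> x; apply: differentiable_continuous; apply/derivable1_diffP.
  exact: ex_derive.
rewrite /Rintegral (@continuous_FTC2 _ _ F)//.
- exact: continuous_subspaceT.
- split.
  + by move=> x _; exact: ex_derive.
  + by apply: cvg_at_right_filter; exact: cF.
  + by apply: cvg_at_left_filter; exact: cF.
- by move=> x _; rewrite derive1E; exact: derive_val.
Qed.

Lemma cintegral_FTC f F a b : a <= b -> ccontinuous f ->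
  (forall x, cder F x (f x)) -> cintegral `[a, b] f = F b - F a.
Proof.
move=> ab [f1 f2] dF; rewrite /cintegral.
rewrite (continuous_FTC ab f1 (fun x => (dF x).1)).
rewrite (continuous_FTC ab f2 (fun x => (dF x).2)).
by case: (F b) (F a) => [? ?] [? ?].
Qed.

(** The two majorants have different roles: [p] makes each [f r] integrable, [q] dominates the
    derivative in [r], as the Leibniz rule asks. All hypotheses are local to []a, b[], since the
    soliton is controlled only on a time interval. *)
Lemma cintegral_derive (f g : R -> R -> C) (a b s : R) (p q : R -> R) :
  mu.-integrable setT (EFin \o p) -> mu.-integrable setT (EFin \o q) ->
  a < s < b ->
  (forall r, a < r < b -> cmeasurable (f r)) ->
  (forall r x, a < r < b -> normc (f r x) <= p x) ->
  (forall r x, a < r < b -> normc (g r x) <= q x) ->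
  (forall r x, a < r < b -> cder (f ^~ x) r (g r x)) ->
  cder (fun r => cintegral setT (f r)) s (cintegral setT (g s)).
Proof.
move=> ip iq sab mf fp gq dfg.
have main (h k : R -> R -> R) :
    (forall r, a < r < b -> mu.-integrable setT (EFin \o h r)) ->
    (forall r x, a < r < b -> `|k r x| <= q x) ->
    (forall r x, a < r < b -> is_derive r 1 (h ^~ x) (k r x)) ->
    is_derive s 1 (fun r => \int[mu]_x h r x) (\int[mu]_x k s x).
  move=> ih kq dh.
  have sI : `]a, b[%classic s by rewrite /= in_itv.
  have ihI r : `]a, b[%classic r -> mu.-integrable setT (EFin \o h r).
    by rewrite /= in_itv; exact: ih.
  have dhI r x : `]a, b[%classic r -> setT x -> derivable (h ^~ x) r 1.
    by rewrite /= in_itv => /(dh _ x) /(@ex_derive _ _ _ _ _ _ _).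
  have partialE r x : a < r < b -> partial1of2 h r x = k r x.
    by move=> /(dh _ x) ?; rewrite partial1of2E derive_val.
  have q0 x : 0 <= q x by exact: le_trans (kq s x sab).
  have bnd r x : `]a, b[%classic r -> setT x -> `|partial1of2 h r x| <= q x.
    by rewrite /= in_itv => rab _; rewrite partialE ?kq.
  have D := derivable_under_integral measurableT sI ihI dhI q0 iq bnd.
  have E := differentiation_under_integral measurableT sI ihI dhI q0 iq bnd.
  apply: DeriveDef => //.
  rewrite -derive1E E; apply: eq_Rintegral => x _; exact: partialE.
have fint r : a < r < b -> cintegrable setT (f r).
  move=> rab; apply: (dominated_cintegrable measurableT (mf r rab) ip) => x _.
  exact: fp.
split.
  apply: (main (fun r x => complex.Re (f r x)) (fun r x => complex.Re (g r x))).
  - by move=> r /fint[].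
  - by move=> r x /(gq r x); exact/le_trans/Re_le_normc.
  - by move=> r x /(dfg r x)[].
apply: (main (fun r x => complex.Im (f r x)) (fun r x => complex.Im (g r x))).
- by move=> r /fint[].
- by move=> r x /(gq r x); exact/le_trans/Im_le_normc.
- by move=> r x /(dfg r x)[].
Qed.

End ComplexIntegral.

(** * Domination by 1/(1+x^2): integrals, tails and L^2 norms *)

Section Decay.
Context {R : realType}.
Local Notation C := R[i].
Local Notation normc := Normc.normc.
Local Notation mu := (@lebesgue_measure R).
Implicit Types (f g : R -> C) (x : R).

Lemma oneDsqr_pos x : 0 < oneDsqr x.
Proof. exact: lt_le_trans ltr01 (oneDsqr_ge1 x). Qed.

Lemma is_derive_atan_scaled (b x : R) : b != 0 ->
  is_derive x 1 (fun y => b^-1 * atan (b * y)) (oneDsqr (b * x))^-1.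
Proof.
move=> b0; have h : is_derive x 1 (fun y => b * y) b.
  by apply: is_derive_eq; rewrite /GRing.scale/= mulr1.
have k : is_derive x 1 (fun y => atan (b * y)) ((oneDsqr (b * x))^-1 * b).
  exact: (is_derive1_comp (is_derive1_atan (b * x)) h).
by apply: is_derive_eq; rewrite /GRing.scale/= mulrCA mulVf ?mulr1.
Qed.

Lemma continuous_oneDsqrV_scaled (b : R) :
  continuous (fun x => (oneDsqr (b * x))^-1).
Proof.
move=> x; apply: (@continuous_comp _ _ _ (fun y => b * y) (fun y => (oneDsqr y)^-1)).
  exact: mulrl_continuous.
exact: continuous_oneDsqrV.
Qed.

(** Twice the integral over the half-line, with primitive [b^-1 * atan (b * y)]. The factor 1/b is
    the source of the scaling of L^2 norms. *)
Lemma integral_oneDsqrV_scaled (b : R) : 0 < b ->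
  (\int[mu]_x (oneDsqr (b * x))^-1%:E = (pi / b)%:E)%E.
Proof.
move=> b0.
rewrite (@ge0_symfun_integralT R (fun x => (oneDsqr (b * x))^-1)); last 3 first.
- by move=> x; rewrite invr_ge0 ltW ?oneDsqr_pos.
- exact: continuous_oneDsqrV_scaled.
- by move=> x /=; rewrite /oneDsqr mulrN sqrrN.
rewrite -set_itvcy.
rewrite (@ge0_continuous_FTC2y _ _ (fun y => b^-1 * atan (b * y)) _ (b^-1 * (pi / 2))).
- by rewrite mulr0 atan0 mulr0 sube0 -EFinM; congr (_%:E); field; rewrite gt_eqF.
- by move=> x _; rewrite invr_ge0 ltW ?oneDsqr_pos.
- by apply: continuous_subspaceT; exact: continuous_oneDsqrV_scaled.
- apply: cvgMl_tmp; apply: (cvg_comp (fun y => b * y) atan); last exact: cvgy_atan.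
  by apply: gt0_cvgMry => //; exact: cvg_id.
- by move=> x _; have := is_derive_atan_scaled x (lt0r_neq0 b0) => ?; exact: ex_derive.
- apply: cvg_at_right_filter.
  have d0 := is_derive_atan_scaled 0 (lt0r_neq0 b0).
  have /differentiable_continuous : differentiable (fun y => b^-1 * atan (b * y)) 0.
    by apply/derivable1_diffP; exact: ex_derive.
  by apply.
- move=> x _; rewrite derive1E.
  by have := is_derive_atan_scaled x (lt0r_neq0 b0) => ?; exact: derive_val.
Qed.

(** The common majorant of the whole proof: its total mass is pi, its tails are given by [atan], and
    dominating it takes only two powers of [x]. *)
Definition weight x : R := (oneDsqr x)^-1.

Lemma weight_gt0 x : 0 < weight x.
Proof. by rewrite invr_gt0 oneDsqr_pos. Qed.

Lemma weight_ge0 x : 0 <= weight x.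
Proof. exact/ltW/weight_gt0. Qed.

Lemma continuous_weight : continuous weight.
Proof. exact: continuous_oneDsqrV. Qed.

Lemma integral_weight : (\int[mu]_x (weight x)%:E = pi%:E)%E.
Proof.
have := integral_oneDsqrV_scaled ltr01; rewrite divr1 => <-.
by apply: eq_integral => x _; rewrite mul1r.
Qed.

Lemma integrable_weight : mu.-integrable setT (EFin \o weight).
Proof.
apply/integrableP; split.
  by apply/measurable_EFinP; apply: continuous_measurable_fun; exact: continuous_weight.
under eq_integral do rewrite /= ger0_norm ?weight_ge0//.
by rewrite integral_weight ltry.
Qed.

Lemma integrableZ_weight (M : R) :
  mu.-integrable setT (EFin \o (fun x => M * weight x)).
Proof.
rewrite (_ : _ \o _ = (fun x => M%:E * (EFin \o weight) x))%E//.
by apply: integrableZl => //; exact: integrable_weight.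
Qed.

Definition decay (M : R) f := forall x, normc (f x) <= M * weight x.

Lemma decay_ge0 M f : decay M f -> 0 <= M.
Proof.
move=> /(_ 0); rewrite /weight /oneDsqr expr0n addr0 invr1 mulr1.
exact/le_trans/normc_ge0.
Qed.

Lemma decay_cintegrable M f : cmeasurable f -> decay M f -> cintegrable setT f.
Proof.
move=> mf fM.
by apply: (dominated_cintegrable _ mf (integrableZ_weight M)) => // x _; exact: fM.
Qed.

Lemma normc_cintegral_decay M f : cmeasurable f -> decay M f ->
  normc (cintegral setT f) <= 2 * pi * M.
Proof.
move=> mf fM.
apply: le_trans.
  apply: (normc_cintegral_le (g := fun x => M * weight x)) => //.
  - exact: decay_cintegrable fM.
  - exact: integrableZ_weight.
rewrite RintegralZl//; last exact: integrable_weight.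
by rewrite {1}/Rintegral integral_weight/= mulrCA mulrC.
Qed.

(** The mass of [weight] outside [-n, n], see [Rintegral_tail]. *)
Definition tail (n : R) : R := pi - 2 * atan n.

Lemma cvg_tail : tail (n%:R) @[n --> \oo] --> 0.
Proof.
rewrite [X in _ --> X](_ : _ = pi - 2 * (pi / 2) :> R); last by field.
apply: cvgB; first exact: cvg_cst.
apply: cvgMl_tmp; apply: (cvg_comp (fun n : nat => n%:R) atan); last exact: cvgy_atan.
exact: cvgr_idn.
Qed.

Lemma Rintegral_tail (n : R) : 0 <= n ->
  \int[mu]_(x in ~` `[- n, n]) weight x = tail n.
Proof.
move=> n0.
have : \int[mu]_x weight x = pi by rewrite /Rintegral integral_weight.
rewrite -(setUv `[- n, n]) Rintegral_setU//=; last 3 first.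
- exact: measurableC.
- by rewrite setUv; exact: integrable_weight.
- by apply/disj_setPS => x [? []].
have -> : \int[mu]_(x in `[- n, n]) weight x = 2 * atan n.
  rewrite (@continuous_FTC _ _ atan).
  - by rewrite atanN opprK mulr_natl mulr2n.
  - by rewrite ge0_cp.
  - exact: continuous_weight.
by rewrite /tail => <-; rewrite addrAC subrr add0r.
Qed.

Lemma normc_tail_le M f (n : R) : 0 <= n -> cmeasurable f -> decay M f ->
  normc (cintegral setT f - cintegral `[- n, n] f) <= 2 * M * tail n.
Proof.
move=> n0 mf fM; have fi := decay_cintegrable mf fM.
rewrite (@cintegral_setC _ `[- n, n])// addrC addKr.
apply: le_trans.
  apply: (normc_cintegral_le (g := fun x => M * weight x)) => //.
  - exact: measurableC.
  - by apply: cintegrableS fi => //; exact: measurableC.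
  - apply: integrableS (integrableZ_weight M) => //; exact: measurableC.
rewrite RintegralZl//.
- by rewrite Rintegral_tail// mulrA.
- exact: measurableC.
- by apply: integrableS integrable_weight => //; exact: measurableC.
Qed.

Lemma cvg_weight : weight n%:R @[n --> \oo] --> (0 : R).
Proof.
apply: (squeeze_cvgr _ (cvg_cst 0) (@cvg_harmonic R)).
near=> n; rewrite weight_ge0/= /weight lef_pV2 ?posrE ?oneDsqr_pos ?ltr0n//.
rewrite /oneDsqr -natr1 addrC lerD2l -natrX ler_nat; case: (n) => // m.
by rewrite -[leqLHS]expn1 leq_pexp2l.
Unshelve. all: end_near. Qed.

(** Over [-n, n] the integral is F(n) - F(-n), at most [2 * N * weight n]; the rest is at most
    [2 * M * tail n]. Both bounds tend to 0. Integrations by parts on the whole line rest on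
    this. *)
Lemma cintegral_derivative M N f F : (forall x, cder F x (f x)) ->
  ccontinuous f -> decay M f -> decay N F -> cintegral setT f = 0.
Proof.
move=> dF cf fM FN; apply: Normc.eq0_normc.
have mf := ccontinuous_measurable cf.
apply/eqP; rewrite eq_le normc_ge0 andbT.
have M0 := decay_ge0 fM.
have N0 := decay_ge0 FN.
have : (2 * M * tail n%:R + 2 * N * weight n%:R) @[n --> \oo] --> (0 : R).
  rewrite -[X in _ --> X]addr0; apply: cvgD.
    rewrite -[X in _ --> X](mulr0 (2 * M)).
    by apply: cvgMl_tmp; exact: cvg_tail.
  rewrite -[X in _ --> X](mulr0 (2 * N)).
  by apply: cvgMl_tmp; exact: cvg_weight.
move=> lim0; apply: (cvgr_to_ge lim0).
near=> n.
have n0 : 0 <= n%:R :> R by [].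
rewrite -[X in normc X](subrK (cintegral `[- n%:R, n%:R] f)).
rewrite (le_trans (le_normcD _ _))//; apply: lerD; first exact: normc_tail_le.
rewrite (cintegral_FTC _ cf dF) ?ge0_cp//.
rewrite (le_trans (normc_sub_le _ _))// -mulrA mulr_natl mulr2n; apply: lerD => //.
by rewrite (le_trans (FN _))// /weight /oneDsqr sqrrN.
Unshelve. all: end_near. Qed.

Lemma measurable_normc f : cmeasurable f ->
  measurable_fun setT (fun x => normc (f x)).
Proof.
move=> [mf1 mf2].
rewrite (_ : (fun x => normc (f x)) = Num.sqrt \o
  (fun x => complex.Re (f x) ^+ 2 + complex.Im (f x) ^+ 2)); last first.
  by apply/funext => x /=; case: (f x).
apply: measurableT_comp.
  by apply: continuous_measurable_fun; exact: sqrt_continuous.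
by apply: measurable_funD; exact: measurable_funX.
Qed.

(** The hypothesis bounds the square of the modulus, and by a dilated weight, so that dilating a
    function by [b] visibly costs a factor b^{-1/2}. *)
Lemma cLnorm2_le (M b : R) f : 0 <= M -> 0 < b -> cmeasurable f ->
  (forall x, normc (f x) ^+ 2 <= M ^+ 2 * (oneDsqr (b * x))^-1) ->
  (cLnorm 2%:E f <= (M * Num.sqrt (pi / b))%:E)%E.
Proof.
move=> M0 b0 mf fM; rewrite /cLnorm unlock /Lnorm.
apply: (@le_trans _ _ ((M ^+ 2 * (pi / b))%:E `^ 2^-1)%E).
  apply: gt0_ler_poweR.
  - by rewrite invr_ge0.
  - rewrite in_itv/= leey andbT; apply: integral_ge0 => x _.
    by rewrite lee_fin powR_ge0.
  - by rewrite in_itv/= leey andbT lee_fin mulr_ge0 ?sqr_ge0// divr_ge0 ?pi_ge0 ?ltW.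
  have mw : measurable_fun setT (fun x => (oneDsqr (b * x))^-1%:E).
    apply/measurable_EFinP; apply: continuous_measurable_fun.
    exact: continuous_oneDsqrV_scaled.
  rewrite EFinM -integral_oneDsqrV_scaled// -ge0_integralZl//.
  - apply: ge0_le_integral => //=.
    + apply/measurable_EFinP.
      apply: (@measurableT_comp _ _ _ _ _ _ (fun x : R => x `^ 2)) => //=.
      by apply: (@measurableT_comp _ _ _ _ _ _ (@Num.norm R R)) => //; exact: measurable_normc.
    + exact: measurable_funeM.
    + move=> x _; rewrite -EFinM lee_fin ger0_norm ?normc_ge0//.
      by rewrite powR_mulrn ?normc_ge0.
  - by rewrite lee_fin sqr_ge0.
rewrite poweR_EFin lee_fin.
have pb0 : 0 <= pi / b by rewrite divr_ge0 ?pi_ge0 ?(ltW b0).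
by rewrite powRM ?sqr_ge0// !powR12_sqrt ?sqr_ge0// sqrtr_sqr ger0_norm.
Qed.

Lemma inL2_le M f : 0 <= M -> cmeasurable f ->
  (forall x, normc (f x) ^+ 2 <= M ^+ 2 * weight x) -> inL2 f.
Proof.
move=> M0 mf fM; split => //.
apply: le_lt_trans (cLnorm2_le M0 ltr01 mf _) (ltry _).
by move=> x; rewrite mul1r.
Qed.

Lemma weight_le1 x : weight x <= 1.
Proof. by rewrite invf_le1 ?oneDsqr_pos ?oneDsqr_ge1. Qed.

(** Since [weight] is at most 1, its square is at most itself; this turns [decay] into the
    hypothesis of [cLnorm2_le]. *)
Lemma decay_sqr_le M f x : decay M f -> normc (f x) ^+ 2 <= M ^+ 2 * weight x.
Proof.
move=> fM; have M0 := decay_ge0 fM.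
rewrite (le_trans (_ : _ <= (M * weight x) ^+ 2))//.
  by rewrite ler_sqr ?nnegrE ?normc_ge0 ?mulr_ge0 ?weight_ge0// fM.
rewrite exprMn ler_wpM2l ?sqr_ge0// expr2.
by rewrite -[leRHS]mulr1 ler_wpM2l ?weight_le1 ?weight_ge0.
Qed.

Lemma decay_inL2 M f : cmeasurable f -> decay M f -> inL2 f.
Proof.
move=> mf fM; apply: inL2_le (decay_ge0 fM) mf _ => x; exact: decay_sqr_le.
Qed.

End Decay.

(** * Fourier transform and inversion *)

Section FourierIntegral.
Context {R : realType}.
Local Notation C := R[i].
Local Notation normc := Normc.normc.
Local Notation mu := (@lebesgue_measure R).
Implicit Types (f g : R -> C) (x xi : R).

Lemma ccontinuousM f g : ccontinuous f -> ccontinuous g ->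
  ccontinuous (fun x => f x * g x).
Proof.
move=> [f1 f2] [g1 g2]; split => x.
  under eq_fun do rewrite Re_mul.
  by apply: (@cvgB R R^o); apply: cvgM; [exact: f1|exact: g1|exact: f2|exact: g2].
under eq_fun do rewrite Im_mul.
by apply: (@cvgD R R^o); apply: cvgM; [exact: f1|exact: g2|exact: f2|exact: g1].
Qed.

Lemma ccontinuousD f g : ccontinuous f -> ccontinuous g ->
  ccontinuous (fun x => f x + g x).
Proof.
move=> [f1 f2] [g1 g2]; split => x.
  under eq_fun do rewrite Re_add.
  by apply: (@cvgD R R^o); [exact: f1|exact: g1].
under eq_fun do rewrite Im_add.
by apply: (@cvgD R R^o); [exact: f2|exact: g2].
Qed.

Lemma ccontinuous_cst (c : C) : ccontinuous (fun _ : R => c).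
Proof. by split => x; exact: cvg_cst. Qed.

Lemma ccontinuous_real (r : R -> R) : continuous r -> ccontinuous (fun x => (r x)%:C%C).
Proof. by move=> cr; split => //= x; exact: cvg_cst. Qed.

Lemma ccontinuous_cis (r : R -> R) : continuous r -> ccontinuous (fun x => cis (r x)).
Proof.
move=> cr; split => x /=.
  exact: (@continuous_comp _ _ _ r cos x (cr x) (@continuous_cos R (r x))).
exact: (@continuous_comp _ _ _ r sin x (cr x) (@continuous_sin R (r x))).
Qed.

Lemma decayD M N f g : decay M f -> decay N g -> decay (M + N) (fun x => f x + g x).
Proof.
move=> fM gN x; rewrite mulrDl (le_trans (le_normcD _ _))//.
by apply: lerD; [exact: fM|exact: gN].
Qed.

Lemma decayZ M (c : C) f : decay M f -> decay (normc c * M) (fun x => c * f x).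
Proof.
by move=> fM x; rewrite Normc.normcM -mulrA ler_wpM2l ?normc_ge0.
Qed.

(** The sign [sg], constrained below by [sg * sg = 1], lets one set of lemmas serve the direct
    transform (-1) and the inverse one (1). Neither is normalised. *)
Definition fourier (sg : R) f : R -> C := fun xi =>
  cintegral setT (fun x => cis (sg * (x * xi)) * f x).

Section OneFunction.
Variable sg : R.
Hypothesis sg2 : sg * sg = 1.

Let cont_ker xi : continuous (fun x : R => sg * (x * xi)).
Proof. by move=> x; apply: cvgMl_tmp; apply: cvgMr_tmp; exact: cvg_id. Qed.

Lemma ccontinuous_ker f xi : ccontinuous f ->
  ccontinuous (fun x => cis (sg * (x * xi)) * f x).
Proof. by move=> cf; apply: ccontinuousM => //; exact: ccontinuous_cis. Qed.

Lemma decay_ker M f xi : decay M f -> decay M (fun x => cis (sg * (x * xi)) * f x).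
Proof. by move=> fM x; rewrite Normc.normcM normc_cis mul1r. Qed.

Lemma cintegrable_ker M f xi : ccontinuous f -> decay M f ->
  cintegrable setT (fun x => cis (sg * (x * xi)) * f x).
Proof.
move=> cf fM; apply: decay_cintegrable (decay_ker xi fM).
exact/ccontinuous_measurable/ccontinuous_ker.
Qed.

Lemma fourierD M N f g xi : ccontinuous f -> decay M f ->
  ccontinuous g -> decay N g ->
  fourier sg (fun x => f x + g x) xi = fourier sg f xi + fourier sg g xi.
Proof.
move=> cf fM cg gN; rewrite /fourier -cintegralD//.
- by apply: eq_cintegral => x _; rewrite mulrDr.
- exact: cintegrable_ker fM.
- exact: cintegrable_ker gN.
Qed.

Lemma fourierZ M (c : C) f xi : ccontinuous f -> decay M f ->
  fourier sg (fun x => c * f x) xi = c * fourier sg f xi.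
Proof.
move=> cf fM; rewrite /fourier -cintegralZ//.
- by apply: eq_cintegral => x _; rewrite mulrCA.
- exact: cintegrable_ker fM.
Qed.

Lemma normc_fourier_le M f xi : ccontinuous f -> decay M f ->
  normc (fourier sg f xi) <= 2 * pi * M.
Proof.
move=> cf fM; apply: normc_cintegral_decay (decay_ker xi fM).
exact/ccontinuous_measurable/ccontinuous_ker.
Qed.

Lemma cder_ker f xi x (g : C) : cder f x g ->
  cder (fun x => cis (sg * (x * xi)) * f x) x
    ((sg * xi)%:C%C * 'i%C * (cis (sg * (x * xi)) * f x) + cis (sg * (x * xi)) * g).
Proof.
move=> fg; have h : is_derive x 1 (fun y => sg * (y * xi)) (sg * xi).
  by apply: is_derive_eq; rewrite /GRing.scale/=; ring.
apply: cder_eq; first exact: (cderM (cder_cis h) fg). by rewrite -!mulrA.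
Qed.

(** The derivative of the kernel times [f] has integral 0 by [cintegral_derivative]; expanding it by
    the product rule relates the two transforms. *)
Lemma fourier_derivative M N f g xi : (forall x, cder f x (g x)) ->
  ccontinuous g -> decay M f -> decay N g ->
  xi%:C%C * fourier sg f xi = sg%:C%C * 'i%C * fourier sg g xi.
Proof.
move=> dfg cg fM gN; have cf := cder_continuous dfg.
have dk x := cder_ker xi (dfg x).
have ck : ccontinuous (fun x => (sg * xi)%:C%C * 'i%C * (cis (sg * (x * xi)) * f x) +
    cis (sg * (x * xi)) * g x).
  apply: ccontinuousD; last exact: ccontinuous_ker.
  by apply: ccontinuousM; [exact: ccontinuous_cst|exact: ccontinuous_ker].
have := cintegral_derivative dk ck
  (decayD (decayZ _ (decay_ker xi fM)) (decay_ker xi gN)) (decay_ker xi fM).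
rewrite cintegralD//; last 2 first.
- by apply: cintegrableZ => //; exact: cintegrable_ker fM.
- exact: cintegrable_ker gN.
rewrite cintegralZ//; last exact: cintegrable_ker fM.
rewrite -!/(fourier _ _ _) => /eqP; rewrite addr_eq0 => /eqP h.
have -> : fourier sg g xi = - ((sg * xi)%:C%C * 'i%C * fourier sg f xi).
  by rewrite h opprK.
have s2 : sg%:C%C * sg%:C%C = 1 :> C by rewrite -rmorphM sg2.
have i2 : 'i%C * 'i%C = -1 :> C by rewrite -expr2 sqr_i.
rewrite rmorphM/= -[LHS]mul1r -s2 -[LHS]opprK -[in LHS]mulN1r -i2; ring.
Qed.

Lemma cder_fourier M N f xi : ccontinuous f -> decay M f ->
  decay N (fun x => x%:C%C * f x) ->
  cder (fourier sg f) xi (fourier sg (fun x => sg%:C%C * 'i%C * (x%:C%C * f x)) xi).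
Proof.
move=> cf fM fN.
apply: (@cintegral_derive R (fun xi x => cis (sg * (x * xi)) * f x)
  (fun xi x => cis (sg * (x * xi)) * (sg%:C%C * 'i%C * (x%:C%C * f x)))
  (xi - 1) (xi + 1) xi (fun x => M * weight x)
  (fun x => (normc (sg%:C%C * 'i%C) * N) * weight x)).
- exact: integrableZ_weight.
- exact: integrableZ_weight.
- by rewrite ltrBlDr !ltrDl ltr01.
- by move=> r _; exact/ccontinuous_measurable/ccontinuous_ker.
- by move=> r x _; exact: decay_ker.
- by move=> r x _; rewrite Normc.normcM normc_cis mul1r; exact: (decayZ _ fN).
- move=> r x _; have h : is_derive r 1 (fun y => sg * (x * y)) (sg * x).
    by apply: is_derive_eq; rewrite /GRing.scale/=; ring.
  apply: cder_eq (cderM (cder_cis h) (cder_cst (f x) r)) _.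
  by rewrite mulr0 addr0 rmorphM/=; ring.
Qed.

End OneFunction.
End FourierIntegral.

(** * Change of variables, Fubini and dominated convergence for complex integrands *)

Section Convergence.
Context {R : realType}.
Local Notation C := R[i].
Local Notation normc := Normc.normc.
Local Notation mu := (@lebesgue_measure R).
Implicit Types (f g : R -> C) (x y xi : R).

Lemma continuous_affine (d y : R) : continuous (fun x : R => y + d * x).
Proof.
move=> x; apply: cvgD; first exact: cvg_cst.
by apply: cvgMl_tmp; exact: cvg_id.
Qed.

Lemma ge0_integral_affine (h : R -> R) (d y : R) : 0 < d -> continuous h ->
  (forall x, 0 <= h x) ->
  (\int[mu]_x (h x)%:E = \int[mu]_x (h (y + d * x) * d)%:E)%E.
Proof.
move=> d0 ch h0.
have dF x : is_derive x 1 (fun x => y + d * x) d.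
  by apply: is_derive_eq; rewrite /GRing.scale/=; ring.
have dE : derive1 (fun x => y + d * x) = cst d.
  by apply/funext => x; rewrite derive1E; have := dF x => ?; exact: derive_val.
rewrite (@increasing_ge0_integration_by_substitutionT R (fun x => y + d * x) h)//.
- by rewrite dE.
- by move=> u v uv; rewrite ltrD2l ltr_pM2l.
- by rewrite dE => x; exact: cvg_cst.
- by rewrite dE; exact: is_cvg_cst.
- by rewrite dE; exact: is_cvg_cst.
- apply: (cvg_comp (fun x => d * x) (fun x => y + x)); last exact: cvg_addrl_Ny.
  by apply: gt0_cvgMrNy => //; exact: cvg_id.
- apply: (cvg_comp (fun x => d * x) (fun x => y + x)); last exact: cvg_addrl.
  by apply: gt0_cvgMry => //; exact: cvg_id.
Qed.

Let ge0_affine (h : R -> R) (d y : R) : 0 < d -> continuous h ->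
  (forall x, 0 <= h x) -> mu.-integrable setT (EFin \o h) ->
  mu.-integrable setT (EFin \o (fun x => h (y + d * x))) /\
  \int[mu]_x h (y + d * x) = d^-1 * \int[mu]_x h x.
Proof.
move=> d0 ch h0 ih.
have chd : continuous (fun x => h (y + d * x)).
  move=> x; apply: (@continuous_comp _ _ _ (fun x => y + d * x) h).
    exact: continuous_affine.
  exact: ch.
have mhd : measurable_fun setT (fun x => h (y + d * x)) by exact: continuous_measurable_fun.
have := ge0_integral_affine y d0 ch h0.
under [RHS]eq_integral do rewrite mulrC EFinM.
rewrite ge0_integralZl//; last 3 first.
- exact/measurable_EFinP.
- by move=> x _; rewrite lee_fin.
- by rewrite lee_fin ltW.
move=> E.
have : (\int[mu]_x (h (y + d * x))%:E < +oo)%E.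
  rewrite ltNge leye_eq; apply/negP => /eqP Eoo; move: E.
  rewrite Eoo gt0_muley ?lte_fin// => E.
  by have := integrable_fin_num measurableT ih; rewrite /comp E.
move=> fin; split.
  apply/integrableP; split; first exact/measurable_EFinP.
  by under eq_integral do rewrite /= ger0_norm//.
rewrite /Rintegral E; move: fin.
have : (0 <= \int[mu]_x (h (y + d * x))%:E)%E by apply: integral_ge0 => x _; rewrite lee_fin.
case: (\int[mu]_x (h (y + d * x))%:E)%E => //= r _ _.
by rewrite mulrA mulVf ?mul1r// gt_eqF.
Qed.

Let real_affine (h : R -> R) (M d y : R) : 0 < d -> continuous h ->
  (forall x, `|h x| <= M * weight x) ->
  \int[mu]_x h (y + d * x) = d^-1 * \int[mu]_x h x.
Proof.
move=> d0 ch hM.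
have iw := integrableZ_weight M.
have cw : continuous (fun x => M * weight x).
  by move=> x; apply: cvgMl_tmp; exact: continuous_weight.
have w0 x : 0 <= M * weight x by exact: le_trans (hM x).
have ih : mu.-integrable setT (EFin \o h).
  apply: le_integrable iw => //=.
    by apply/measurable_EFinP; exact: continuous_measurable_fun.
  by move=> x _; rewrite lee_fin (ger0_norm (w0 x)).
(* The substitution rule is for nonnegative functions: it is applied to [h + M * weight] and to
   [M * weight], and the results are subtracted. *)
have cp : continuous (fun x => h x + M * weight x).
  by move=> x; apply: cvgD; [exact: ch|exact: cw].
have p0 x : 0 <= h x + M * weight x.
  by have := hM x; rewrite ler_norml => /andP[? _]; lra.
have ip : mu.-integrable setT (EFin \o (fun x => h x + M * weight x)).
  rewrite (_ : _ \o _ = (EFin \o h) \+ (EFin \o (fun x => (M * weight x)%R)))%E//.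
  exact: integrableD.
have [ip' Ep] := ge0_affine y d0 cp p0 ip.
have [iw' Ew] := ge0_affine y d0 cw w0 iw.
transitivity (\int[mu]_x ((h (y + d * x) + M * weight (y + d * x)) - M * weight (y + d * x))).
  by apply: eq_Rintegral => x _; rewrite addrK.
rewrite RintegralB// Ep Ew RintegralD// mulrDr addrK//.
Qed.

Lemma cintegral_affine M f (d y : R) : 0 < d -> ccontinuous f -> decay M f ->
  cintegral setT (fun x => f (y + d * x)) = (d^-1)%:C%C * cintegral setT f.
Proof.
move=> d0 [cf1 cf2] fM; rewrite /cintegral.
rewrite (real_affine (M := M) y d0 cf1); last first.
  by move=> x; rewrite (le_trans (Re_le_normc _)).
rewrite (real_affine (M := M) y d0 cf2); last first.
  by move=> x; rewrite (le_trans (Im_le_normc _)).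
by apply/eqP; rewrite eq_complex/= !mul0r subr0 addr0 !eqxx.
Qed.

(** A majorant in product form makes both components jointly integrable, because its iterated
    integral is a product of two finite integrals. *)
Lemma cintegral_fubini (F : R -> R -> C) (p q : R -> R) :
  mu.-integrable setT (EFin \o p) -> mu.-integrable setT (EFin \o q) ->
  (forall x, 0 <= p x) -> (forall x, 0 <= q x) ->
  measurable_fun setT (fun z : R * R => complex.Re (F z.1 z.2)) ->
  measurable_fun setT (fun z : R * R => complex.Im (F z.1 z.2)) ->
  (forall x y, normc (F x y) <= p x * q y) ->
  cintegral setT (fun x => cintegral setT (F x)) =
  cintegral setT (fun y => cintegral setT (F ^~ y)).
Proof.
move=> ip iq p0 q0 mF1 mF2 Fpq.
have main (h : R * R -> R) : measurable_fun setT h ->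
    (forall x y, `|h (x, y)| <= p x * q y) ->
    \int[mu]_x \int[mu]_y h (x, y) = \int[mu]_y \int[mu]_x h (x, y).
  move=> mh hpq.
  have ihx x : mu.-integrable setT (fun y => (h (x, y))%:E).
    have := integrableZl measurableT (p x) iq; apply: le_integrable => //=.
      by apply/measurable_EFinP; exact: (measurableT_comp mh (measurable_pair1 x)).
    by move=> y _; rewrite lee_fin (le_trans (hpq x y)) ?ler_norm.
  have ihy y : mu.-integrable setT (fun x => (h (x, y))%:E).
    have := integrableZl measurableT (q y) ip; apply: le_integrable => //=.
      by apply/measurable_EFinP; exact: (measurableT_comp mh (measurable_pair2 y)).
    by move=> x _; rewrite lee_fin (le_trans (hpq x y))// mulrC ler_norm.
  have ih : (mu \x mu)%E.-integrable setT (EFin \o h).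
    apply/integrable12ltyP; first exact/measurable_EFinP.
    have QE : (\int[mu]_y (q y)%:E)%E = (\int[mu]_y q y)%:E.
      by rewrite /Rintegral fineK//; exact: integrable_fin_num.
    apply: (@le_lt_trans _ _ (\int[mu]_x ((\int[mu]_y q y)%:E * (p x)%:E))%E).
      apply: ge0_le_integral => //=.
      - by move=> x _; apply: integral_ge0.
      - have mabs : measurable_fun setT (fun z => `|(h z)%:E|%E).
          by apply: measurableT_comp => //; exact/measurable_EFinP.
        exact: (measurable_fun_fubini_tonelli_F (m2 := mu) _ mabs (fun z => abse_ge0 _)).
      - by apply: measurable_funeM; case/integrableP : ip.
      - move=> x _; rewrite -QE muleC -ge0_integralZl//.
        + apply: ge0_le_integral => //=.
          * apply/measurable_EFinP.
            apply: (@measurableT_comp _ _ _ _ _ _ (@Num.norm R R)) => //.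
            exact: (measurableT_comp mh (measurable_pair1 x)).
          * by apply: measurable_funeM; case/integrableP : iq.
          * by move=> y _; rewrite lee_fin.
        + by case/integrableP : iq.
        + by move=> y _; rewrite lee_fin.
        + by rewrite lee_fin.
    case/integrableP : (integrableZl measurableT (\int[mu]_y q y) ip) => _.
    apply: le_lt_trans; rewrite le_eqVlt; apply/orP; left; apply/eqP.
    apply: eq_integral => x _ /=.
    by rewrite ger0_norm// mulr_ge0// Rintegral_ge0.
  rewrite /Rintegral; congr fine.
  rewrite (_ : (\int[mu]_x (fine (\int[mu]_x0 (h (x, x0))%:E))%:E)%E =
     (\int[mu]_x (\int[mu]_x0 (h (x, x0))%:E))%E); last first.
    by apply: eq_integral => x _; rewrite fineK//; exact: integrable_fin_num.
  rewrite (_ : (\int[mu]_x (fine (\int[mu]_x0 (h (x0, x))%:E))%:E)%E =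
     (\int[mu]_x (\int[mu]_x0 (h (x0, x))%:E))%E); last first.
    by apply: eq_integral => x _; rewrite fineK//; exact: integrable_fin_num.
  exact: (Fubini ih).
rewrite /cintegral/=; congr (_ +i* _)%C.
  apply: (main (fun z => complex.Re (F z.1 z.2))) => // x y.
  by rewrite (le_trans (Re_le_normc _)).
apply: (main (fun z => complex.Im (F z.1 z.2))) => // x y.
by rewrite (le_trans (Im_le_normc _)).
Qed.

Lemma cintegral_dominated_cvg (F_ : nat -> R -> C) f (g : R -> R) :
  mu.-integrable setT (EFin \o g) ->
  (forall n, cmeasurable (F_ n)) -> cmeasurable f ->
  (forall n x, normc (F_ n x) <= g x) ->
  (forall x, normc (F_ n x - f x) @[n --> \oo] --> 0) ->
  normc (cintegral setT (F_ n) - cintegral setT f) @[n --> \oo] --> 0.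
Proof.
move=> ig mF mf Fg Ff.
have main (h_ : nat -> R -> R) (h : R -> R) :
    (forall n, measurable_fun setT (h_ n)) -> measurable_fun setT h ->
    (forall n x, `|h_ n x| <= g x) ->
    (forall x, `|h_ n x - h x| @[n --> \oo] --> 0) ->
    `|\int[mu]_x h_ n x - \int[mu]_x h x| @[n --> \oo] --> 0.
  move=> mh_ mh hg hh.
  have mE n : measurable_fun setT (fun x => (h_ n x)%:E) by exact/measurable_EFinP.
  have cvgE : {ae mu, forall x, setT x -> (h_ n x)%:E @[n --> \oo] --> (h x)%:E}.
    apply: aeW => x _; apply: cvg_EFin; first exact: nearW.
    by rewrite /comp/=; apply/subr_cvg0/norm_cvg0P; exact: hh.
  have domE : {ae mu, forall x n, setT x -> (`|(h_ n x)%:E| <= (g x)%:E)%E}.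
    by apply: aeW => x n _; rewrite lee_fin.
  have mhE : measurable_fun setT (fun x => (h x)%:E) by exact/measurable_EFinP.
  have [ih _ lim] := @dominated_convergence _ _ _ mu setT measurableT
     (fun n x => (h_ n x)%:E) (fun x => (h x)%:E) (fun x => (g x)%:E) mE mhE cvgE ig domE.
  apply/norm_cvg0P/subr_cvg0; apply: fine_cvg.
  by rewrite {1}/Rintegral fineK//; exact: integrable_fin_num.
have re := main (fun n x => complex.Re (F_ n x)) (fun x => complex.Re (f x)).
have im := main (fun n x => complex.Im (F_ n x)) (fun x => complex.Im (f x)).
have dRe (z w : C) : `|complex.Re z - complex.Re w| <= normc (z - w).
  by rewrite (le_trans _ (Re_le_normc _))// Re_add Re_opp.
have dIm (z w : C) : `|complex.Im z - complex.Im w| <= normc (z - w).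
  by rewrite (le_trans _ (Im_le_normc _))// Im_add Im_opp.
have sq (u v : nat -> R) : (forall n, 0 <= u n <= v n) ->
    v n @[n --> \oo] --> 0 -> u n @[n --> \oo] --> 0.
  by move=> uv v0; apply: (squeeze_cvgr _ (cvg_cst 0) v0); exact: nearW.
apply: (sq _ (fun n => `|complex.Re (cintegral setT (F_ n)) - complex.Re (cintegral setT f)| +
    `|complex.Im (cintegral setT (F_ n)) - complex.Im (cintegral setT f)|)).
  move=> n; apply/andP; split; first exact: normc_ge0.
  by apply: le_trans (normc_le _) _; rewrite Re_add Re_opp Im_add Im_opp.
rewrite -[X in _ --> X]addr0; apply: cvgD.
  apply: re.
  - by move=> n; case: (mF n).
  - by case: mf.
  - by move=> n x; rewrite (le_trans (Re_le_normc _)).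
  - by move=> x; apply: sq (Ff x) => n; rewrite normr_ge0 ?dRe ?dIm.
apply: im.
- by move=> n; case: (mF n).
- by case: mf.
- by move=> n x; rewrite (le_trans (Im_le_normc _)).
- by move=> x; apply: sq (Ff x) => n; rewrite normr_ge0 ?dRe ?dIm.
Qed.

End Convergence.

(** * The Gaussian and its Fourier transform *)

Section Gaussian.
Context {R : realType}.
Local Notation C := R[i].
Local Notation normc := Normc.normc.
Local Notation mu := (@lebesgue_measure R).
Implicit Types (f g : R -> C) (x y xi : R).

Definition cgauss : R -> C := fun x => (gauss_fun x)%:C%C.

Lemma decay_cgauss : decay 1 cgauss.
Proof.
move=> x; rewrite normc_real ger0_norm ?gauss_fun_ge0// mul1r /gauss_fun expRN.
by rewrite /weight lef_pV2 ?posrE ?expR_gt0 ?oneDsqr_pos// /oneDsqr expR_ge1Dx.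
Qed.

Lemma decay_mul_cgauss : decay 2 (fun x => x%:C%C * cgauss x).
Proof.
move=> x; rewrite Normc.normcM !normc_real (ger0_norm (gauss_fun_ge0 x)).
rewrite /gauss_fun expRN /weight ler_pdivrMr ?expR_gt0//.
rewrite mulrAC ler_pdivlMr ?oneDsqr_pos//.
(* This is 1 + t <= e^t at t = x^2/2, squared: the linear bound at x^2 itself gains only two powers
   of x, while |x| (1 + x^2) has degree three. *)
have h : (1 + x ^+ 2 / 2) ^+ 2 <= expR (x ^+ 2).
  have -> : x ^+ 2 = x ^+ 2 / 2 + x ^+ 2 / 2 by field.
  rewrite expRD -expr2 ler_sqr ?nnegrE ?expR_ge0//.
    by rewrite -splitr expR_ge1Dx.
  by rewrite addr_ge0// -splitr divr_ge0// sqr_ge0.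
apply: (@le_trans _ _ (2 * (1 + x ^+ 2 / 2) ^+ 2)); last by rewrite ler_pM2l.
rewrite /oneDsqr -(real_normK (num_real x)).
move: `|x| (normr_ge0 x) => t t0; have := sqr_ge0 (1 - t).
have := sqr_ge0 t; nra.
Qed.

Lemma is_derive_gauss x : is_derive x 1 gauss_fun (- 2 * (x * gauss_fun x)).
Proof.
have h : is_derive x 1 (fun y : R => - y ^+ 2) (- (2 * x)).
  by apply: is_derive_eq; rewrite /GRing.scale/=; ring.
by apply: is_derive_eq (is_derive1_comp (is_derive_expR _) h) _; rewrite /gauss_fun; ring.
Qed.

Lemma cder_cgauss x : cder cgauss x ((- 2)%:C%C * (x%:C%C * cgauss x)).
Proof.
apply: cder_eq (cder_real (is_derive_gauss x)) _.
by rewrite /cgauss !rmorphM.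
Qed.

Lemma ccontinuous_cgauss : ccontinuous cgauss.
Proof. exact: cder_continuous cder_cgauss. Qed.

Lemma ccontinuous_id : ccontinuous (fun x : R => x%:C%C).
Proof. by apply: ccontinuous_real => x; exact: cvg_id. Qed.

Section Transform.
Variable sg : R.
Hypothesis sg2 : sg * sg = 1.

(** Differentiating the transform multiplies the Gaussian g by x, and x g = - g' / 2 turns this back
    into multiplication of the transform by xi. *)
Lemma cder_fourier_cgauss xi :
  cder (fourier sg cgauss) xi (- (xi / 2)%:C%C * fourier sg cgauss xi).
Proof.
have cxg : ccontinuous (fun x => x%:C%C * cgauss x).
  exact: ccontinuousM ccontinuous_id ccontinuous_cgauss.
apply: cder_eq (cder_fourier sg xi ccontinuous_cgauss decay_cgauss decay_mul_cgauss) _.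
rewrite (fourierZ _ _ _ cxg decay_mul_cgauss).
have := fourier_derivative sg2 xi cder_cgauss _ decay_cgauss (decayZ _ decay_mul_cgauss).
rewrite (fourierZ _ _ _ cxg decay_mul_cgauss) => E.
have {}E := E (ccontinuousM (ccontinuous_cst _) cxg).
have -> : - (xi / 2)%:C%C * fourier sg cgauss xi =
  - (2^-1)%:C%C * (xi%:C%C * fourier sg cgauss xi) by rewrite rmorphM/=; ring.
rewrite E; have -> : (- 2)%:C%C = - 2 :> C by rewrite rmorphN rmorph_nat.
by rewrite fmorphV rmorph_nat; field.
Qed.

Lemma fourier_cgauss xi : fourier sg cgauss xi =
  (Num.sqrt pi * expR (- (xi ^+ 2 / 4)))%:C%C.
Proof.
(* An integrating factor for the equation of [cder_fourier_cgauss]: the product with the transform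
   is constant, and its value at 0 is the Gaussian integral. *)
pose e x : R := expR (x ^+ 2 / 4).
have de x : is_derive x 1 e (x / 2 * e x).
  have h : is_derive x 1 (fun y : R => y ^+ 2 / 4) (x / 2).
    by apply: is_derive_eq; rewrite /GRing.scale/=; field.
  by apply: is_derive_eq (is_derive1_comp (is_derive_expR _) h) _; rewrite /e; ring.
have d0 x : cder (fun x => fourier sg cgauss x * (e x)%:C%C) x 0.
  apply: cder_eq (cderM (cder_fourier_cgauss x) (cder_real (de x))) _.
  by rewrite (rmorphM _ (x / 2)); ring.
have g0 : fourier sg cgauss 0 = (Num.sqrt pi)%:C%C.
  rewrite /fourier /cintegral; congr (_ +i* _)%C.
    rewrite /Rintegral -[RHS]/(fine (Num.sqrt pi)%:E) -integralT_gauss; congr fine.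
    by apply: eq_integral => x _; rewrite mulr0 mulr0 cis0 mul1r.
  rewrite (_ : (fun x => _) = cst 0); last first.
    by apply/funext => x; rewrite mulr0 mulr0 cis0 mul1r.
  by rewrite /Rintegral integral0.
have : fourier sg cgauss xi * (e xi)%:C%C = fourier sg cgauss 0 * (e 0)%:C%C.
  apply/eqP; rewrite eq_complex; apply/andP; split; apply/eqP.
    exact: (is_derive_0_is_cst xi 0 (fun x => (d0 x).1)).
  exact: (is_derive_0_is_cst xi 0 (fun x => (d0 x).2)).
rewrite g0 {2}/e expr0n mul0r expR0 rmorph1 mulr1 => E.
rewrite rmorphM/= -E -mulrA -rmorphM/= /e expRN mulfV ?rmorph1 ?mulr1//.
by rewrite gt_eqF// expR_gt0.
Qed.

(** The 4 comes from e^{-x^2/4} <= 1/(1 + x^2/4) <= 4/(1 + x^2). *)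
Lemma decay_fourier_cgauss : decay (4 * Num.sqrt pi) (fourier sg cgauss).
Proof.
move=> x; rewrite fourier_cgauss normc_real ger0_norm; last first.
  by rewrite mulr_ge0 ?sqrtr_ge0 ?expR_ge0.
rewrite [leRHS](_ : _ = Num.sqrt pi * (4 * weight x)); last by ring.
rewrite ler_wpM2l ?sqrtr_ge0// expRN /weight.
have -> : 4 * (oneDsqr x)^-1 = (oneDsqr x / 4)^-1 by rewrite invfM invrK mulrC.
rewrite lef_pV2 ?posrE ?expR_gt0//.
rewrite (le_trans _ (expR_ge1Dx _))// /oneDsqr.
by have := sqr_ge0 x; lra.
Qed.

End Transform.

(* The constant [2 pi] of the inversion formula; only [fconst != 0] is used. *)
Definition fconst : C :=
  cintegral setT (fun xi => (Num.sqrt pi * expR (- (xi ^+ 2 / 4)))%:C%C).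

(** Since e^{-x^2/4} >= e^{-x^2}, the real part is at least the integral of sqrt(pi) e^{-x^2}, which
    is pi. *)
Lemma fconst_neq0 : fconst != 0.
Proof.
suff : 0 < complex.Re fconst by apply: contraTneq => ->; rewrite ltxx.
rewrite /fconst /cintegral/=.
apply: (@lt_le_trans _ _ (\int[mu]_x (Num.sqrt pi * gauss_fun x))).
  rewrite RintegralZl//; last exact: integrableT_gauss.
  rewrite /Rintegral integralT_gauss/= -expr2 sqr_sqrtr ?pi_ge0 ?pi_gt0//.
apply: le_Rintegral => //.
- rewrite (_ : _ \o _ = (fun x => (Num.sqrt pi)%:E * (EFin \o gauss_fun) x))%E//.
  by apply: integrableZl => //; exact: integrableT_gauss.
- have one2 : 1 * 1 = 1 :> R by rewrite mulr1.
  have c1 : ccontinuous (fourier 1 cgauss) := cder_continuous (cder_fourier_cgauss one2).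
  have [h _] := decay_cintegrable (ccontinuous_measurable c1) (decay_fourier_cgauss one2).
  by move: h; under [X in EFin \o X]eq_fun do rewrite (fourier_cgauss one2).
- move=> x _; rewrite ler_wpM2l ?sqrtr_ge0// ler_expR lerN2.
  by have := sqr_ge0 x; lra.
Qed.

End Gaussian.

(** * Fourier inversion by Gaussian averaging *)

Section Inversion.
Context {R : realType}.
Local Notation C := R[i].
Local Notation normc := Normc.normc.
Local Notation mu := (@lebesgue_measure R).
Implicit Types (f g : R -> C) (x y xi : R).

Lemma cvg0_le (u v : nat -> R) : (forall n, 0 <= u n <= v n) ->
  v n @[n --> \oo] --> 0 -> u n @[n --> \oo] --> 0.
Proof.
by move=> uv v0; apply: (squeeze_cvgr _ (cvg_cst 0) v0); exact: nearW.
Qed.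

Lemma cvg0D (u v : nat -> R) : u n @[n --> \oo] --> 0 ->
  v n @[n --> \oo] --> 0 -> (u n + v n) @[n --> \oo] --> 0.
Proof. by move=> u0 v0; rewrite -[X in _ --> X]addr0; exact: cvgD. Qed.

Lemma normc_cvg f (u : nat -> R) y : ccontinuous f -> u n @[n --> \oo] --> y ->
  normc (f (u n) - f y) @[n --> \oo] --> 0.
Proof.
move=> [cf1 cf2] uy.
have c1 : `|complex.Re (f (u n)) - complex.Re (f y)| @[n --> \oo] --> 0.
  apply/norm_cvg0P/subr_cvg0.
  exact: (cvg_comp u (fun x => complex.Re (f x)) uy (cf1 y)).
have c2 : `|complex.Im (f (u n)) - complex.Im (f y)| @[n --> \oo] --> 0.
  apply/norm_cvg0P/subr_cvg0.
  exact: (cvg_comp u (fun x => complex.Im (f x)) uy (cf2 y)).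
apply: cvg0_le (cvg0D c1 c2) => n.
apply/andP; split; first exact: normc_ge0.
by apply: le_trans (normc_le _) _; rewrite Re_add Re_opp Im_add Im_opp.
Qed.

Lemma normc_cvgZ (c : nat -> C) (M : R) (d : nat -> C) :
  (forall n, normc (d n) <= M) -> normc (c n) @[n --> \oo] --> 0 ->
  normc (d n * c n) @[n --> \oo] --> 0.
Proof.
move=> dM c0.
have h : (M * normc (c n)) @[n --> \oo] --> 0.
  by rewrite -[X in _ --> X](mulr0 M); apply: cvgMl_tmp.
apply: cvg0_le h => n.
by rewrite normc_ge0 Normc.normcM ler_wpM2r ?normc_ge0.
Qed.

Let cmeas2 (F : R * R -> C) :=
  measurable_fun setT (fun z => complex.Re (F z)) /\
  measurable_fun setT (fun z => complex.Im (F z)).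

Let cmeas2M (F G : R * R -> C) : cmeas2 F -> cmeas2 G -> cmeas2 (fun z => F z * G z).
Proof.
move=> [F1 F2] [G1 G2]; split.
  under eq_fun do rewrite Re_mul.
  by apply: measurable_funB; apply: measurable_funM.
under eq_fun do rewrite Im_mul.
by apply: measurable_funD; apply: measurable_funM.
Qed.

Let cmeas2_cis (r : R * R -> R) : measurable_fun setT r -> cmeas2 (fun z => cis (r z)).
Proof.
move=> mr; split => /=.
  apply: (measurableT_comp (f := cos)) => //.
  by apply: continuous_measurable_fun; exact: continuous_cos.
apply: (measurableT_comp (f := sin)) => //.
by apply: continuous_measurable_fun; exact: continuous_sin.
Qed.

Let cmeas2_comp f (r : R * R -> R) : ccontinuous f -> measurable_fun setT r ->
  cmeas2 (fun z => f (r z)).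
Proof.
move=> [f1 f2] mr; split.
  exact: (measurableT_comp (continuous_measurable_fun f1) mr).
exact: (measurableT_comp (continuous_measurable_fun f2) mr).
Qed.

Variables (sg : R) (f : R -> C) (M N : R).
Hypothesis sg2 : sg * sg = 1.
Hypothesis cf : ccontinuous f.
Hypothesis fM : decay M f.
Hypothesis cTf : ccontinuous (fourier sg f).
Hypothesis TfN : decay N (fourier sg f).

Let bounded_f x : normc (f x) <= M.
Proof.
by rewrite (le_trans (fM x))// -[leRHS]mulr1 ler_wpM2l ?weight_le1 ?(decay_ge0 fM).
Qed.

Let continuous_scale (d : R) : continuous (fun x : R => d * x).
Proof. by move=> x; apply: cvgMl_tmp; exact: cvg_id. Qed.

Let ccontinuous_comp g (r : R -> R) : ccontinuous g -> continuous r ->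
  ccontinuous (fun x => g (r x)).
Proof.
move=> [g1 g2] cr; split => x.
  exact: (@continuous_comp _ _ _ r (fun x => complex.Re (g x)) x (cr x) (g1 (r x))).
exact: (@continuous_comp _ _ _ r (fun x => complex.Im (g x)) x (cr x) (g2 (r x))).
Qed.

Let cTg : ccontinuous (fourier sg cgauss).
Proof. exact: cder_continuous (cder_fourier_cgauss sg2). Qed.

(* Averaging [fourier sg f] against the dilated Gaussian, Fubini's theorem moves
   the Fourier integral onto the Gaussian. *)
Let gauss_average (d y : R) : 0 < d ->
  cintegral setT (fun xi => cis (- sg * (xi * y)) * fourier sg f xi * cgauss (d * xi)) =
  cintegral setT (fun v => f (y + d * v) * fourier sg cgauss v).
Proof.
move=> d0.
(* The Gaussian factor supplies the integrability in [xi] that the bare kernel does not have, so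
   that [F] has a majorant in product form. *)
pose F xi x := cis (sg * ((x - y) * xi)) * f x * cgauss (d * xi).
have iG : mu.-integrable setT (EFin \o (fun xi => gauss_fun (d * xi))).
  have [mgd _] := ccontinuous_measurable
    (ccontinuous_comp (@ccontinuous_cgauss R) (@continuous_scale d)).
  have iw : mu.-integrable setT (EFin \o (fun xi => (oneDsqr (d * xi))^-1)).
    apply/integrableP; split.
      apply/measurable_EFinP; apply: continuous_measurable_fun.
      exact: continuous_oneDsqrV_scaled.
    under eq_integral do rewrite /= ger0_norm ?invr_ge0 ?(ltW (oneDsqr_pos _))//.
    by rewrite integral_oneDsqrV_scaled ?ltry.
  apply: le_integrable iw => //=; first exact/measurable_EFinP.
  move=> x _; rewrite lee_fin !ger0_norm ?gauss_fun_ge0 ?invr_ge0 ?(ltW (oneDsqr_pos _))//.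
  have := decay_cgauss (d * x).
  by rewrite normc_real ger0_norm ?gauss_fun_ge0// mul1r.
have mF : cmeas2 (fun z => F z.1 z.2).
  apply: cmeas2M; last first.
    apply: cmeas2_comp; first exact: ccontinuous_cgauss.
    by apply: measurable_funM.
  apply: cmeas2M; last exact: cmeas2_comp.
  apply: cmeas2_cis; apply: measurable_funM => //; apply: measurable_funM => //.
  exact: measurable_funB.
transitivity (cintegral setT (fun xi => cintegral setT (F xi))).
  apply: eq_cintegral => xi _; rewrite /fourier mulrAC.
  rewrite -cintegralZ//; last exact: cintegrable_ker fM.
  apply: eq_cintegral => x _; rewrite /F.
  rewrite (_ : sg * ((x - y) * xi) = - sg * (xi * y) + sg * (x * xi)); last by ring.
  by rewrite cisD; ring.
rewrite (@cintegral_fubini R F (fun xi => gauss_fun (d * xi))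
  (fun x => M * weight x))//; first last.
- move=> xi x; rewrite /F !Normc.normcM normc_cis mul1r mulrC.
  by rewrite ler_pM ?normc_ge0 ?fM// normc_real ger0_norm ?gauss_fun_ge0.
- by case: mF.
- by case: mF.
- by move=> x; rewrite mulr_ge0 ?weight_ge0 ?(decay_ge0 fM).
- by move=> x; exact: gauss_fun_ge0.
- exact: integrableZ_weight.
pose G x := f x * fourier sg cgauss (d^-1 * (x - y)).
have cG : ccontinuous G.
  apply: ccontinuousM => //; apply: ccontinuous_comp => // x.
  by apply: cvgMl_tmp; apply: cvgB; [exact: cvg_id|exact: cvg_cst].
have GM : decay (M * (4 * Num.sqrt pi)) G.
  move=> x; rewrite Normc.normcM mulrAC.
  apply: ler_pM; [exact: normc_ge0|exact: normc_ge0|exact: fM|].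
  apply: le_trans (decay_fourier_cgauss sg2 _) _.
  by rewrite -[leRHS]mulr1 ler_wpM2l ?weight_le1// mulr_ge0 ?sqrtr_ge0.
transitivity ((d^-1)%:C%C * cintegral setT G); last first.
  rewrite -(cintegral_affine y d0 cG GM); apply: eq_cintegral => v _.
  by rewrite /G addrAC subrr add0r mulKf// gt_eqF.
rewrite -cintegralZ//; last by apply: decay_cintegrable GM; exact: ccontinuous_measurable.
apply: eq_cintegral => x _.
rewrite /G mulrCA /fourier.
rewrite -(cintegral_affine (M := 1) 0 d0); last 2 first.
- exact: ccontinuous_ker (@ccontinuous_cgauss R).
- exact: (decay_ker sg _ (@decay_cgauss R)).
rewrite -cintegralZ//.
  apply: eq_cintegral => xi _; rewrite /F add0r.
  rewrite (_ : sg * (d * xi * (d^-1 * (x - y))) = sg * ((x - y) * xi)); last first.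
    by field; rewrite gt_eqF.
  by ring.
apply: (dominated_cintegrable measurableT _ iG).
  apply: ccontinuous_measurable.
  exact: (ccontinuous_comp (ccontinuous_ker sg (d^-1 * (x - y))
    (@ccontinuous_cgauss R)) (@continuous_affine R d 0)).
move=> xi _; rewrite add0r Normc.normcM normc_cis mul1r normc_real.
by rewrite ger0_norm ?gauss_fun_ge0.
Qed.

(** The two sides of [gauss_average] have different limits as d tends to 0. On the left the Gaussian
    cutoff tends to 1 ([L]), with majorant from the decay of the transform; on the right f(y + d v)
    tends to f(y) ([Q]), with majorant from the decay of the transformed Gaussian. *)
Theorem fourier_inversion y : fourier (- sg) (fourier sg f) y = fconst * f y.
Proof.
pose d n : R := n.+1%:R^-1.
have d0 n : 0 < d n by rewrite invr_gt0.
have dcvg : d n @[n --> \oo] --> 0 by exact: cvg_harmonic.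
have dx x : (d n * x) @[n --> \oo] --> (0 : R).
  by rewrite -[X in _ --> X](mul0r x); apply: cvgMr_tmp.
have L : normc (cintegral setT (fun xi => cis (- sg * (xi * y)) * fourier sg f xi *
    cgauss (d n * xi)) - fourier (- sg) (fourier sg f) y) @[n --> \oo] --> 0.
  apply: (cintegral_dominated_cvg (integrableZ_weight N)).
  - move=> n; apply: ccontinuous_measurable; apply: ccontinuousM.
      exact: ccontinuous_ker.
    exact: ccontinuous_comp (@ccontinuous_cgauss R) (@continuous_scale _).
  - by apply: ccontinuous_measurable; exact: ccontinuous_ker.
  - move=> n x; rewrite !Normc.normcM normc_cis mul1r -[leRHS]mulr1 ler_pM ?normc_ge0 ?TfN//.
    by rewrite normc_real ger0_norm ?gauss_fun_ge0 ?gauss_fun_le1.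
  - move=> x; under eq_fun do rewrite -{2}(mulr1 (_ * fourier sg f x)) -mulrBr.
    apply: (normc_cvgZ (M := normc (cis (- sg * (x * y)) * fourier sg f x))) => //.
    have := normc_cvg (@ccontinuous_cgauss R) (dx x).
    by rewrite /cgauss /gauss_fun expr0n oppr0 expR0.
have Q : normc (cintegral setT (fun v => f (y + d n * v) * fourier sg cgauss v) -
    fconst * f y) @[n --> \oo] --> 0.
  rewrite mulrC.
  rewrite (_ : f y * fconst = cintegral setT (fun v => f y * fourier sg cgauss v)); last first.
    rewrite cintegralZ//; last first.
      by apply: decay_cintegrable (decay_fourier_cgauss sg2); exact: ccontinuous_measurable.
    by congr (_ * _); apply: eq_cintegral => x _; rewrite fourier_cgauss.
  apply: (cintegral_dominated_cvg (integrableZ_weight (M * (4 * Num.sqrt pi)))).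
  - move=> n; apply: ccontinuous_measurable; apply: ccontinuousM => //.
    exact: ccontinuous_comp (@continuous_affine _ _ _).
  - by apply: ccontinuous_measurable; apply: ccontinuousM => //; exact: ccontinuous_cst.
  - move=> n x; rewrite Normc.normcM -mulrA ler_pM ?normc_ge0//.
    exact: decay_fourier_cgauss.
  - move=> x; under eq_fun do rewrite -mulrBl mulrC.
    apply: (normc_cvgZ (M := normc (fourier sg cgauss x))) => //.
    apply: normc_cvg => //; rewrite -[X in _ --> X]addr0.
    by apply: cvgD => //; exact: cvg_cst.
have LQ := cvg0D L Q.
apply/eqP; rewrite -subr_eq0; apply/eqP/Normc.eq0_normc/eqP.
rewrite eq_le normc_ge0 andbT; apply: (cvgr_to_ge LQ); apply: nearW => n.
rewrite gauss_average//; set A := cintegral _ _; set B := fourier _ _ _; set D := _ * f y.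
rewrite -(normcN (A - B)) opprB (_ : B - D = (B - A) + (A - D)) ?le_normcD//.
by rewrite addrA subrK.
Qed.

End Inversion.

(** * Schwartz families and the free evolution *)

Section SchwartzFamily.
Context {R : realType}.
Local Notation C := R[i].
Local Notation normc := Normc.normc.
Local Notation mu := (@lebesgue_measure R).
Implicit Types (f g h : R -> R -> C) (K : (R -> R -> C) -> Prop) (s x y xi : R).

Lemma real_complexM (x y : R) : (x * y)%:C%C = x%:C%C * y%:C%C :> C.
Proof. by rewrite rmorphM. Qed.

Lemma real_complexD (x y : R) : (x + y)%:C%C = x%:C%C + y%:C%C :> C.
Proof. by rewrite rmorphD. Qed.

Lemma real_complexX (x : R) n : (x ^+ n)%:C%C = x%:C%C ^+ n :> C.
Proof. by rewrite rmorphXn. Qed.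

Lemma real_complex_nat n : (n%:R)%:C%C = n%:R :> C.
Proof. by rewrite rmorph_nat. Qed.

(* Families [f s x] on [a < s < b] which are Schwartz in [x], smooth in [s],
   uniformly in [s]: all the seminorms are bounded because every iterate of the
   closure operations is again dominated by a multiple of [weight]. *)
Record schwartz_family (a b : R) K : Prop := SchwartzFamily {
  schwartz_add : forall f g, K f -> K g -> K (fun s x => f s x + g s x) ;
  schwartz_scale : forall (c : C) f, K f -> K (fun s x => c * f s x) ;
  schwartz_mul_time : forall f, K f -> K (fun s x => s%:C%C * f s x) ;
  schwartz_mul_space : forall f, K f -> K (fun s x => x%:C%C * f s x) ;
  schwartz_d_space : forall f, K f -> exists2 g, K g &
    forall s x, a < s < b -> cder (f s) x (g s x) ;
  schwartz_d_time : forall f, K f -> exists2 g, K g &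
    forall s x, a < s < b -> cder (f ^~ x) s (g s x) ;
  schwartz_decay : forall f, K f -> exists M, forall s, a < s < b -> decay M (f s)
}.

(* The multiplier is a quadratic phase with coefficient affine in time, so that
   one closure lemma covers the Fourier transform and the free evolution. *)
Definition fourier_family (a b : R) K (sg p q : R) h : Prop :=
  exists2 f, K f & forall s xi, a < s < b ->
    h s xi = cis ((p * s + q) * xi ^+ 2) * fourier sg (f s) xi.

Section Closure.
Variables (a b : R) (K : (R -> R -> C) -> Prop).
Hypothesis SK : schwartz_family a b K.

Lemma schwartz_continuous f s : K f -> a < s < b -> ccontinuous (f s).
Proof.
move=> /(schwartz_d_space SK)[g _ fg] sab.
exact: (cder_continuous (fun x => fg s x sab)).
Qed.

Variable sg : R.
Hypothesis sg2 : sg * sg = 1.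

Lemma schwartz_fourierD f g s xi : K f -> K g -> a < s < b ->
  fourier sg (fun x => f s x + g s x) xi = fourier sg (f s) xi + fourier sg (g s) xi.
Proof.
move=> Kf Kg sab.
have [M fM] := schwartz_decay SK Kf; have [N gN] := schwartz_decay SK Kg.
by apply: fourierD (fM _ sab) _ (gN _ sab); exact: schwartz_continuous.
Qed.

Lemma schwartz_fourierZ (c : C) f s xi : K f -> a < s < b ->
  fourier sg (fun x => c * f s x) xi = c * fourier sg (f s) xi.
Proof.
move=> Kf sab; have [M fM] := schwartz_decay SK Kf.
by apply: fourierZ (fM _ sab); exact: schwartz_continuous.
Qed.

Lemma schwartz_fourier_derivative f g s xi : K f -> K g -> a < s < b ->
  (forall x, cder (f s) x (g s x)) ->
  xi%:C%C * fourier sg (f s) xi = sg%:C%C * 'i%C * fourier sg (g s) xi.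
Proof.
move=> Kf Kg sab fg.
have [M fM] := schwartz_decay SK Kf; have [N gN] := schwartz_decay SK Kg.
by apply: (fourier_derivative sg2 xi fg _ (fM _ sab) (gN _ sab)); exact: schwartz_continuous.
Qed.

Lemma schwartz_cder_fourier f s xi : K f -> a < s < b ->
  cder (fourier sg (f s)) xi
    (fourier sg (fun x => sg%:C%C * 'i%C * (x%:C%C * f s x)) xi).
Proof.
move=> Kf sab.
have [M fM] := schwartz_decay SK Kf.
have [N fN] := schwartz_decay SK (schwartz_mul_space SK Kf).
by apply: cder_fourier (fM _ sab) (fN _ sab); exact: schwartz_continuous.
Qed.

Lemma schwartz_cder_fourier_time f g s xi : K f -> K g -> a < s < b ->
  (forall s x, a < s < b -> cder (f ^~ x) s (g s x)) ->
  cder (fun s => fourier sg (f s) xi) s (fourier sg (g s) xi).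
Proof.
move=> Kf Kg sab fg.
have [M fM] := schwartz_decay SK Kf; have [N gN] := schwartz_decay SK Kg.
apply: (cintegral_derive (f := fun s x => cis (sg * (x * xi)) * f s x)
  (g := fun s x => cis (sg * (x * xi)) * g s x)
  (integrableZ_weight M) (integrableZ_weight N) sab).
- move=> r rab; apply: ccontinuous_measurable; apply: ccontinuous_ker.
  exact: schwartz_continuous.
- by move=> r x rab; apply: decay_ker; exact: fM.
- by move=> r x rab; apply: decay_ker; exact: gN.
- by move=> r x rab; apply: cderZ; exact: fg.
Qed.

Variables p q : R.
Local Notation FK := (fourier_family a b K sg p q).

Let near_time s : a < s < b -> \forall r \near s, a < r < b.
Proof.
move=> /andP[sa sb]; near=> r; apply/andP; split.
  by near: r; exact: lt_nbhsr.
by near: r; exact: lt_nbhsl.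
Unshelve. all: end_near. Qed.

Let phase r xi : R := (p * r + q) * xi ^+ 2.

Let fourier_mul_space f : K f -> exists2 g, K g &
  forall s xi, a < s < b -> xi%:C%C * fourier sg (f s) xi = fourier sg (g s) xi.
Proof.
move=> Kf; have [g Kg fg] := schwartz_d_space SK Kf.
exists (fun s x => sg%:C%C * 'i%C * g s x); first exact: (schwartz_scale SK).
move=> s xi sab; rewrite (schwartz_fourier_derivative _ Kf Kg)//.
  by rewrite schwartz_fourierZ.
by move=> x; exact: fg.
Qed.

(** The transform exchanges multiplication by the variable with differentiation. The phase
    contributes a factor 2 (p s + q) xi to the derivative in xi and p xi^2 to the one in s; powers
    of xi are absorbed as space derivatives, and s by closure under [schwartz_mul_time]. *)
Lemma schwartz_fourier_family : schwartz_family a b FK.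
Proof.
split.
- move=> h k [f Kf hf] [g Kg kg]; exists (fun s x => f s x + g s x).
    exact: (schwartz_add SK).
  by move=> s xi sab; rewrite schwartz_fourierD// mulrDr hf// kg.
- move=> c h [f Kf hf]; exists (fun s x => c * f s x); first exact: (schwartz_scale SK).
  by move=> s xi sab; rewrite schwartz_fourierZ// hf// mulrCA.
- move=> h [f Kf hf]; exists (fun s x => s%:C%C * f s x); first exact: (schwartz_mul_time SK).
  move=> s xi sab; rewrite hf// mulrCA; congr (_ * _).
  by rewrite -(schwartz_fourierZ _ _ Kf sab).
- move=> h [f Kf hf]; have [g Kg fg] := fourier_mul_space Kf.
  by exists g => // s xi sab; rewrite hf// mulrCA fg.
- move=> h [f Kf hf]; have [g Kg fg] := fourier_mul_space Kf.
  have Kxf : K (fun s x => sg%:C%C * 'i%C * (x%:C%C * f s x)).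
    exact: (schwartz_scale SK _ (schwartz_mul_space SK Kf)).
  have Kpg : K (fun s x => (2 * p)%:C%C * 'i%C * (s%:C%C * g s x) +
      (2 * q)%:C%C * 'i%C * g s x).
    exact: (schwartz_add SK (schwartz_scale SK _ (schwartz_mul_time SK Kg))
      (schwartz_scale SK _ Kg)).
  have Kk := schwartz_add SK Kpg Kxf.
  exists (fun s xi => cis (phase s xi) * fourier sg (fun x =>
    ((2 * p)%:C%C * 'i%C * (s%:C%C * g s x) + (2 * q)%:C%C * 'i%C * g s x) +
    sg%:C%C * 'i%C * (x%:C%C * f s x)) xi).
    by eexists; [exact: Kk|].
  move=> s xi sab.
  have -> : h s = fun xi => cis (phase s xi) * fourier sg (f s) xi.
    by apply/funext => z; exact: hf.
  have dp : is_derive xi 1 (phase s) (2 * (p * s + q) * xi).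
    by apply: is_derive_eq; rewrite /GRing.scale/=; ring.
  apply: cder_eq (cderM (cder_cis dp) (schwartz_cder_fourier xi Kf sab)) _.
  rewrite (schwartz_fourierD _ Kpg Kxf sab).
  rewrite (schwartz_fourierD _
    (schwartz_scale SK ((2 * p)%:C%C * 'i%C) (schwartz_mul_time SK Kg))
    (schwartz_scale SK _ Kg) sab).
  rewrite (schwartz_fourierZ _ _ (schwartz_mul_time SK Kg) sab).
  rewrite !(schwartz_fourierZ _ _ Kg sab) -fg//.
  by rewrite !(real_complexM, real_complexD); ring.
- move=> h [f Kf hf].
  have [g Kg fg] := fourier_mul_space Kf; have [k Kk gk] := fourier_mul_space Kg.
  have [l Kl fl] := schwartz_d_time SK Kf.
  have Kpk := schwartz_scale SK (p%:C%C * 'i%C) Kk.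
  have Km := schwartz_add SK Kpk Kl.
  exists (fun s xi => cis (phase s xi) *
      fourier sg (fun x => p%:C%C * 'i%C * k s x + l s x) xi).
    by eexists; [exact: Km|].
  move=> s xi sab.
  apply: (@near_eq_cder _ (fun s => cis (phase s xi) * fourier sg (f s) xi)).
    by apply: filterS (near_time sab) => r rab; rewrite hf.
  have dp : is_derive s 1 (phase^~ xi) (p * xi ^+ 2).
    by apply: is_derive_eq; rewrite /GRing.scale/=; ring.
  apply: cder_eq (cderM (cder_cis dp) (schwartz_cder_fourier_time xi Kf Kl sab fl)) _.
  rewrite (schwartz_fourierD _ Kpk Kl sab) (schwartz_fourierZ _ _ Kk sab).
  by rewrite -gk// -fg// real_complexM real_complexX; ring.
- move=> h [f Kf hf].
  have [g Kg fg] := fourier_mul_space Kf; have [k Kk gk] := fourier_mul_space Kg.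
  (* The transform of [f + k] is (1 + xi^2) times that of [f], so its boundedness is the required
     decay. *)
  have [M fM] := schwartz_decay SK (schwartz_add SK Kf Kk).
  exists (2 * pi * M) => s sab xi.
  rewrite hf// Normc.normcM normc_cis mul1r /weight ler_pdivlMr ?oneDsqr_pos//.
  have : normc (fourier sg (fun x => f s x + k s x) xi) <= 2 * pi * M.
    apply: normc_fourier_le; last exact: fM.
    by apply: (schwartz_continuous (schwartz_add SK Kf Kk)).
  rewrite (schwartz_fourierD _ Kf Kk sab) -gk// -fg//.
  rewrite -{1}(mul1r (fourier sg (f s) xi)) mulrA -mulrDl Normc.normcM mulrC.
  have -> : 1 + xi%:C%C * xi%:C%C = (oneDsqr xi)%:C%C :> C.
    by rewrite /oneDsqr rmorphD rmorph1 rmorphXn.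
  by rewrite normc_real ger0_norm ?(ltW (oneDsqr_pos _)).
Qed.

End Closure.
End SchwartzFamily.

(** * The free Schrodinger evolution on Schwartz families *)

Section FreeEvolution.
Context {R : realType}.
Local Notation C := R[i].
Local Notation normc := Normc.normc.
Local Notation mu := (@lebesgue_measure R).
Implicit Types (f g : R -> C) (K : (R -> R -> C) -> Prop) (s x y xi : R).

Lemma truncated_fourierE n f xi :
  truncated_fourier n f xi = cintegral `[- n%:R, n%:R] (fun x => cis (-1 * (x * xi)) * f x).
Proof. by apply: eq_cintegral => x _; rewrite mulN1r. Qed.

Let N1N1 : -1 * -1 = 1 :> R. Proof. by rewrite mulrNN mulr1. Qed.

Lemma cintegral_mkcond (D : set R) f :
  cintegral D f = cintegral setT (fun x => if x \in D then f x else 0).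
Proof.
rewrite /cintegral Rintegral_mkcond [X in (_ +i* X)%C]Rintegral_mkcond.
by congr (_ +i* _)%C; apply: eq_Rintegral => x _; rewrite patchE; case: ifP.
Qed.

(** Measurability comes from differentiability in xi: on [-n, n] the factor x that the kernel
    releases is at most n, so the Leibniz rule applies to the cut-off function. *)
Lemma cmeasurable_truncated n M f : ccontinuous f -> decay M f ->
  cmeasurable (truncated_fourier n f).
Proof.
move=> cf fM; pose I : set R := [set` `[- n%:R, n%:R]].
pose F x := if x \in I then f x else 0.
have FM : decay M F.
  move=> x; rewrite /F; case: ifP => // _.
  by rewrite Normc.normc0 mulr_ge0 ?weight_ge0 ?(decay_ge0 fM).
have mF : cmeasurable F.
  have [m1 m2] := ccontinuous_measurable cf.
  have mI : measurable I by exact: measurable_itv.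
  split.
    rewrite (_ : (fun x => _) = (fun x => complex.Re (f x)) \_ I).
      by apply/(measurable_restrictT _ mI); exact: measurable_funTS.
    by apply/funext => x; rewrite patchE /F; case: ifP.
  rewrite (_ : (fun x => _) = (fun x => complex.Im (f x)) \_ I).
    by apply/(measurable_restrictT _ mI); exact: measurable_funTS.
  by apply/funext => x; rewrite patchE /F; case: ifP.
have xFn : decay (n%:R * M) (fun x => x%:C%C * F x).
  move=> x; rewrite Normc.normcM normc_real -mulrA.
  rewrite /F; case: ifPn => [|_]; last first.
    by rewrite Normc.normc0 mulr0 !mulr_ge0 ?weight_ge0 ?(decay_ge0 fM).
  rewrite inE /I/= in_itv/= -ler_norml => xn.
  by rewrite ler_pM ?normc_ge0 ?fM.
have d xi : cder (truncated_fourier n f) xi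
    (cintegral setT (fun x => cis (- (x * xi)) * ((- x)%:C%C * 'i%C * F x))).
  rewrite (_ : truncated_fourier n f = fun xi =>
    cintegral setT (fun x => cis (- (x * xi)) * F x)); last first.
    apply/funext => z; rewrite /truncated_fourier cintegral_mkcond.
    by apply: eq_cintegral => x _; rewrite /F; case: ifP; rewrite ?mulr0.
  apply: (@cintegral_derive R (fun xi x => cis (- (x * xi)) * F x)
    (fun xi x => cis (- (x * xi)) * ((- x)%:C%C * 'i%C * F x))
    (xi - 1) (xi + 1) xi (fun x => M * weight x) (fun x => (n%:R * M) * weight x)).
  - exact: integrableZ_weight.
  - exact: integrableZ_weight.
  - by rewrite ltrBlDr !ltrDl ltr01.
  - move=> r _; apply: cmeasurableM => //.
    apply: ccontinuous_measurable; apply: ccontinuous_cis => x.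
    by apply: cvgN; apply: cvgMr_tmp; exact: cvg_id.
  - by move=> r x _; rewrite Normc.normcM normc_cis mul1r; exact: FM.
  - move=> r x _; rewrite !Normc.normcM normc_cis mul1r normc_i mulr1 normc_real normrN.
    by rewrite -normc_real -Normc.normcM; exact: xFn.
  - move=> r x _; have h : is_derive r 1 (fun y => - (x * y)) (- x).
      by apply: is_derive_eq; rewrite /GRing.scale/=; ring.
    apply: cder_eq (cderM (cder_cis h) (cder_cst (F x) r)) _.
    by rewrite mulr0 addr0 mulrA (mulrC (cis _)).
exact: ccontinuous_measurable (cder_continuous d).
Qed.

Let trunc_le1 M f n xi : ccontinuous f -> decay M f ->
  normc (truncated_fourier n f xi - fourier (-1) f xi) <= 2 * M * tail n%:R.
Proof.
move=> cf fM; rewrite truncated_fourierE -normcN opprB.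
apply: normc_tail_le => //; last exact: decay_ker.
by apply: ccontinuous_measurable; exact: ccontinuous_ker.
Qed.

(** Integration by parts on [-n, n] ([E1]) minus integration by parts on the line ([E2]): the
    boundary terms give [weight n], the truncation error of the derivative gives [tail n]. *)
Let trunc_le2 M N f g n xi : (forall x, cder f x (g x)) -> ccontinuous g ->
  decay M f -> decay N g ->
  `|xi| * normc (truncated_fourier n f xi - fourier (-1) f xi) <=
  2 * M * weight n%:R + 2 * N * tail n%:R.
Proof.
move=> fg cg fM gN; have cf := cder_continuous fg.
have n0 : 0 <= n%:R :> R by [].
have dk x := cder_ker (-1) xi (fg x).
pose c : C := (-1 * xi)%:C%C * 'i%C.
have ik h L : ccontinuous h -> decay L h ->
    cintegrable setT (fun x => cis (-1 * (x * xi)) * h x).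
  by move=> ch hL; exact: cintegrable_ker hL.
have ikn h L : ccontinuous h -> decay L h ->
    cintegrable `[- n%:R, n%:R] (fun x => cis (-1 * (x * xi)) * h x).
  by move=> ch hL; apply: cintegrableS (ik _ _ ch hL).
have ck : ccontinuous (fun x => c * (cis (-1 * (x * xi)) * f x) + cis (-1 * (x * xi)) * g x).
  apply: ccontinuousD; last exact: ccontinuous_ker.
  by apply: ccontinuousM; [exact: ccontinuous_cst|exact: ccontinuous_ker].
have E1 : c * truncated_fourier n f xi + truncated_fourier n g xi =
    cis (-1 * (n%:R * xi)) * f n%:R - cis (-1 * (- n%:R * xi)) * f (- n%:R).
  rewrite -(cintegral_FTC _ ck dk) ?ge0_cp//.
  rewrite cintegralD ?cintegralZ -?truncated_fourierE//.
  - exact: ikn cf fM.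
  - by apply: cintegrableZ => //; exact: ikn cf fM.
  - exact: ikn cg gN.
have E2 : c * fourier (-1) f xi + fourier (-1) g xi = 0.
  have := cintegral_derivative dk ck (decayD (decayZ _ (decay_ker (-1) xi fM))
    (decay_ker (-1) xi gN)) (decay_ker (-1) xi fM).
  rewrite cintegralD ?cintegralZ//.
  - exact: ik cf fM.
  - by apply: cintegrableZ => //; exact: ik cf fM.
  - exact: ik cg gN.
have nc : normc c = `|xi|.
  by rewrite /c Normc.normcM normc_i mulr1 normc_real mulN1r normrN.
rewrite -nc -Normc.normcM.
have -> : c * (truncated_fourier n f xi - fourier (-1) f xi) =
    (cis (-1 * (n%:R * xi)) * f n%:R - cis (-1 * (- n%:R * xi)) * f (- n%:R)) -
    (truncated_fourier n g xi - fourier (-1) g xi).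
  rewrite -E1 -[in RHS](subr0 (_ * _ + _)) -E2; ring.
apply: le_trans (normc_sub_le _ _) _; apply: lerD; last exact: trunc_le1.
apply: le_trans (normc_sub_le _ _) _.
rewrite !Normc.normcM !normc_cis !mul1r -mulrA mulr_natl mulr2n; apply: lerD; first exact: fM.
by rewrite (le_trans (fM _))// /weight /oneDsqr sqrrN.
Qed.

Lemma squeeze0e (u : nat -> \bar R) (v : nat -> R) :
  (forall n, (0 <= u n <= (v n)%:E)%E) -> v n @[n --> \oo] --> 0 ->
  u n @[n --> \oo] --> 0%E.
Proof.
move=> uv v0; apply: (@squeeze_cvge _ _ _ _ (cst 0%E) _ (fun n => (v n)%:E)).
- exact: nearW.
- exact: cvg_cst.
- by apply: cvg_EFin => //; exact: nearW.
Qed.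

Section Family.
Variables (a b : R) (K : (R -> R -> C) -> Prop).
Hypothesis SK : schwartz_family a b K.
Variables (f : R -> R -> C) (s : R).
Hypotheses (Kf : K f) (sab : a < s < b).

(* One integration by parts bounds the truncation error by [E n / (1 + |xi|)] with
   [E n --> 0], which gives the convergence in [L^2] without Plancherel. *)
Lemma schwartz_is_fourier : is_fourier (f s) (fourier (-1) (f s)).
Proof.
have [M /(_ s sab) fM] := schwartz_decay SK Kf.
have cf := schwartz_continuous SK Kf sab.
have [g Kg /(_ s _ sab) fg] := schwartz_d_space SK Kf.
have [N /(_ s sab) gN] := schwartz_decay SK Kg.
have cg := schwartz_continuous SK Kg sab.
have M0 := decay_ge0 fM; have N0 := decay_ge0 gN.
(* With [p = q = 0] the phase is 1 and the family consists of plain transforms. *)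
have SFK := schwartz_fourier_family SK N1N1 0 0.
have Kff : fourier_family a b K (-1) 0 0 (fun s => fourier (-1) (f s)).
  by exists f => // r xi _; rewrite mul0r add0r mul0r cis0 mul1r.
have cff := schwartz_continuous SFK Kff sab.
have [L /(_ s sab) fL] := schwartz_decay SFK Kff.
split.
- by apply: decay_inL2 fM; exact: ccontinuous_measurable.
- by apply: decay_inL2 fL; exact: ccontinuous_measurable.
- pose E n : R := 2 * M * tail n%:R + (2 * M * weight n%:R + 2 * N * tail n%:R).
  have tail_ge0 n : 0 <= tail n%:R :> R.
    rewrite -Rintegral_tail//; apply: Rintegral_ge0 => x _; exact: weight_ge0.
  have E0 n : 0 <= E n by rewrite !addr_ge0 ?mulr_ge0 ?weight_ge0.
  apply: (@squeeze0e _ (fun n => E n * Num.sqrt (pi / 1))); last first.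
    rewrite -[X in _ --> X](mul0r (Num.sqrt (pi / 1))); apply: cvgMr_tmp.
    have cz (c : R) (u : nat -> R) : u n @[n --> \oo] --> 0 -> (c * u n) @[n --> \oo] --> 0.
      by move=> u0; rewrite -[X in _ --> X](mulr0 c); exact: cvgMl_tmp.
    apply: cvg0D; first by apply: cz; exact: cvg_tail.
    by apply: cvg0D; apply: cz; [exact: cvg_weight|exact: cvg_tail].
  move=> n; rewrite Lnorm_ge0/=; apply: cLnorm2_le => //.
    rewrite (_ : _ \- _ = fun xi =>
      truncated_fourier n (f s) xi + -1 * fourier (-1) (f s) xi); last first.
      by apply/funext => xi; rewrite mulN1r.
    apply: cmeasurableD; first exact: cmeasurable_truncated cf fM.
    by apply: cmeasurableZ; exact: ccontinuous_measurable.
  move=> xi; rewrite mul1r ler_pdivlMr ?oneDsqr_pos//.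
  have h1 := trunc_le1 n xi cf fM.
  have h2 := trunc_le2 n xi fg cg fM gN.
  suff key D : 0 <= D -> D <= 2 * M * tail n%:R ->
      `|xi| * D <= 2 * M * weight n%:R + 2 * N * tail n%:R ->
      D ^+ 2 * oneDsqr xi <= E n ^+ 2 by exact: key (normc_ge0 _) h1 h2.
  move=> D0 {}h1 {}h2.
  (* From 1 + xi^2 <= (1 + |xi|)^2, the two bounds on [D] and [|xi| * D] add up to [E n], and the
     error becomes square integrable in [xi]. *)
  have : D ^+ 2 * oneDsqr xi <= (D + `|xi| * D) ^+ 2.
    rewrite /oneDsqr -(real_normK (num_real xi)).
    have : 0 <= `|xi| * D * D by rewrite !mulr_ge0.
    by move: `|xi| => t; nra.
  move/le_trans; apply; rewrite ler_sqr ?nnegrE ?addr_ge0 ?mulr_ge0 ?weight_ge0//.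
  exact: lerD.
Qed.

End Family.

(** An explicit pointwise formula for S(t) f; [fconst^-1] normalises the pair of transforms. *)
Definition free_evolution t f : R -> C := fun y =>
  fconst^-1 * fourier 1 (fun xi => cis (- (t * xi ^+ 2)) * fourier (-1) f xi) y.

Lemma schwartz_is_schrodinger (a b : R) K (f : R -> R -> C) s t :
  schwartz_family a b K -> K f -> a < s < b ->
  is_schrodinger t (f s) (free_evolution t (f s)).
Proof.
move=> SK Kf sab.
have N1 : 1 * 1 = 1 :> R by rewrite mulr1.
exists (fourier (-1) (f s)); split; first exact: (schwartz_is_fourier SK Kf sab).
pose h (r xi : R) := cis (- (t * xi ^+ 2)) * fourier (-1) (f r) xi.
have SK1 := schwartz_fourier_family SK N1N1 0 (- t).
have K1h : fourier_family a b K (-1) 0 (- t) h.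
  by exists f => // r xi _; rewrite /h mul0r add0r mulNr.
have SK2 := schwartz_fourier_family SK1 N1 0 0.
have K2h : fourier_family a b (fourier_family a b K (-1) 0 (- t)) 1 0 0
    (fun r => fourier 1 (h r)).
  by exists h => // r xi _; rewrite mul0r add0r mul0r cis0 mul1r.
(* The free evolution lies in a Schwartz family, so its L^2 transform is the integral one, and
   inversion identifies that integral with [h s]. *)
have := schwartz_is_fourier SK2 (schwartz_scale SK2 fconst^-1 K2h) sab.
congr is_fourier; apply/funext => xi.
rewrite (schwartz_fourierZ SK2 _ _ _ K2h sab).
have [M /(_ s sab) hM] := schwartz_decay SK1 K1h.
have [N /(_ s sab) hN] := schwartz_decay SK2 K2h.
rewrite (fourier_inversion N1 _ hM _ hN).
- by rewrite mulKf// fconst_neq0.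
- exact: (schwartz_continuous SK1 K1h sab).
- exact: (schwartz_continuous SK2 K2h sab).
Qed.

Lemma free_evolution0 (a b : R) K (f : R -> R -> C) s :
  schwartz_family a b K -> K f -> a < s < b ->
  free_evolution 0 (f s) = f s.
Proof.
move=> SK Kf sab.
have SK1 := schwartz_fourier_family SK N1N1 0 0.
have K1f : fourier_family a b K (-1) 0 0 (fun r => fourier (-1) (f r)).
  by exists f => // r xi _; rewrite mul0r add0r mul0r cis0 mul1r.
have [M /(_ s sab) fM] := schwartz_decay SK Kf.
have [N /(_ s sab) fN] := schwartz_decay SK1 K1f.
apply/funext => y; rewrite /free_evolution.
rewrite (_ : (fun xi => _) = fourier (-1) (f s)); last first.
  by apply/funext => xi; rewrite mul0r oppr0 cis0 mul1r.
(* Writing 1 as -(-1) gives the inversion formula with [sg = -1]. *)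
rewrite -{1}[1]opprK (fourier_inversion N1N1 _ fM _ fN).
- by rewrite mulKf// fconst_neq0.
- exact: (schwartz_continuous SK Kf sab).
- exact: (schwartz_continuous SK1 K1f sab).
Qed.

End FreeEvolution.

(** * Duhamel formula *)

Section RiemannSums.
Context {R : realType}.
Local Notation C := R[i].
Local Notation normc := Normc.normc.
Local Notation mu := (@lebesgue_measure R).
Implicit Types (K : (R -> R -> C) -> Prop) (s x y xi : R).

Lemma MVT_between (f df : R -> R) (a b p q : R) : a < p -> p <= q -> q < b ->
  (forall x, a < x < b -> is_derive x 1 f (df x)) ->
  exists2 c, p <= c <= q & f q - f p = df c * (q - p).
Proof.
move=> ap pq qb dfab.
have [||c] := @MVT_segment R f df p q pq.
- move=> x; rewrite in_itv/= => /andP[px xq]; apply: dfab.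
  by rewrite (lt_trans ap px) (lt_trans xq qb).
- apply: derivable_within_continuous => x; rewrite in_itv/= => /andP[px xq].
  by apply: ex_derive; apply: dfab; rewrite (lt_le_trans ap px) (le_lt_trans xq qb).
by rewrite in_itv/= => cpq E; exists c.
Qed.

(** Two mean value theorems: the increment of [f] is g(d) (q - p) for some d, and g(c) - g(d) is at
    most [L * (q - p)] in modulus because c and d both lie in [p, q]. *)
Lemma riemann_step_le (f g h : R -> R) (a b p q c L : R) :
  a < p -> p <= c <= q -> q < b ->
  (forall x, a < x < b -> is_derive x 1 f (g x)) ->
  (forall x, a < x < b -> is_derive x 1 g (h x)) ->
  (forall x, a < x < b -> `|h x| <= L) ->
  `|(q - p) * g c - (f q - f p)| <= L * (q - p) ^+ 2.
Proof.
move=> ap /andP[pc cq] qb fg gh hL.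
have pq := le_trans pc cq.
have [d /andP[pd dq] ->] := MVT_between ap pq qb fg.
rewrite mulrC -mulrBl normrM (ger0_norm (_ : 0 <= q - p)) ?subr_ge0//.
rewrite expr2 mulrA ler_wpM2r ?subr_ge0//.
have L0 : 0 <= L by apply: le_trans (hL p _); rewrite ?normr_ge0// ap (le_lt_trans pq qb).
have [dc|cd] := leP d c.
  have [|e /andP[de ec] ->] := MVT_between (lt_le_trans ap pd) dc _ gh.
    exact: le_lt_trans qb.
  rewrite normrM ler_pM// ?hL//.
    by rewrite (lt_le_trans ap (le_trans pd de)) (le_lt_trans (le_trans ec cq) qb).
  by rewrite ger0_norm ?subr_ge0// lerB.
have [|e /andP[ce ed] E] := MVT_between (lt_le_trans ap pc) (ltW cd) _ gh.
  exact: le_lt_trans qb.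
rewrite distrC E normrM ler_pM// ?hL//.
  by rewrite (lt_le_trans ap (le_trans pc ce)) (le_lt_trans (le_trans ed dq) qb).
by rewrite ger0_norm ?subr_ge0 ?(le_trans ce ed)// lerB.
Qed.

(* The Lipschitz bound on [W] is pointwise in [y] with a square integrable
   constant, so Riemann sums converge in [L^2] from the mean value theorem. *)
Lemma is_integral_L2_FTC (a b T : R) (v W Z : R -> R -> C) (M : R) :
  a < 0 -> 0 <= T -> T < b ->
  (forall s, a < s < b -> cmeasurable (v s)) ->
  (forall s, 0 <= s <= T -> inL2 (W s)) ->
  inL2 (fun y => v T y - v 0 y) ->
  (forall s y, a < s < b -> cder (v ^~ y) s (W s y)) ->
  (forall s y, a < s < b -> cder (W ^~ y) s (Z s y)) ->
  (forall s, a < s < b -> decay M (Z s)) ->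
  is_integral_L2 0 T W (fun y => v T y - v 0 y).
Proof.
move=> a0 T0 Tb mv W2 V2 vW WZ ZM; split=> // eps eps0.
have M0 : 0 <= M by apply: (decay_ge0 (ZM 0 _)); rewrite a0 (le_lt_trans T0 Tb).
(* The error is at most delta times the first summand; the 1 makes the inequality strict and [D]
   positive even for [T = 0]. *)
pose D := 2 * M * T * Num.sqrt (pi / 1) + 1.
have D0 : 0 < D by rewrite ltr_wpDl// !mulr_ge0 ?sqrtr_ge0.
have [delta delta0 deltaE] : exists2 delta, 0 < delta & delta * D = eps.
  by exists (eps / D); [rewrite divr_gt0|rewrite divfK ?gt_eqF].
exists delta => // n x c x0 xn xc.
have xmono i j : (i <= j <= n)%N -> x i <= x j.
  elim: j => [|j IH]; first by rewrite leqn0 => /andP[/eqP->].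
  rewrite leq_eqVlt => /andP[/predU1P[->//|ij] jn].
  have [xj cj _] := xc j jn.
  by rewrite (le_trans (IH _)) ?(le_trans xj cj)// -ltnS ij ltnW.
have xin i : (i <= n)%N -> 0 <= x i <= T.
  by move=> ni; rewrite -x0 -xn !xmono// ?leqnn ?ni.
have inab s : 0 <= s <= T -> a < s < b.
  by move=> /andP[s0 sT]; rewrite (lt_le_trans a0 s0) (le_lt_trans sT Tb).
have cin i : (i < n)%N -> 0 <= c i <= T.
  move=> ni; have [xi ci _] := xc i ni.
  have /andP[h1 _] := xin i (ltnW ni); have /andP[_ h2] := xin i.+1 ni.
  by rewrite (le_trans h1 xi) (le_trans ci h2).
(* Each cell then costs at most M weight(y) (x_{i+1} - x_i)^2 in either component; one factor is
   below delta, the other ones sum to [T]. *)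
have telescope y : v T y - v 0 y = \sum_(i < n) (v (x i.+1) y - v (x i) y).
  rewrite -xn -x0; elim: (n) => [|m IH]; first by rewrite big_ord0 subrr.
  by rewrite big_ord_recr/= -IH; ring.
have bound y : normc (\sum_(i < n) (x i.+1 - x i)%:C%C * W (c i) y - (v T y - v 0 y)) <=
    2 * M * T * delta * weight y.
  rewrite telescope -sumrB.
  have nsum m (z : nat -> C) (r : nat -> R) : (forall i, (i < m)%N -> normc (z i) <= r i) ->
      normc (\sum_(i < m) z i) <= \sum_(i < m) r i.
    elim: m => [|m IH] zr; first by rewrite !big_ord0 Normc.normc0.
    rewrite !big_ord_recr/= (le_trans (le_normcD _ _))// lerD ?zr// IH// => i im.
    by rewrite zr// ltnW.
  apply: (@le_trans _ _ (\sum_(i < n) (2 * (M * weight y) * delta * (x i.+1 - x i)))).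
    apply: (nsum n (fun i => (x i.+1 - x i)%:C%C * W (c i) y - (v (x i.+1) y - v (x i) y))
      (fun i => 2 * (M * weight y) * delta * (x i.+1 - x i))) => i ni.
    have [xi ci di] := xc i ni.
    have /andP[p0 _] := inab _ (xin i (ltnW ni)).
    have /andP[_ q0] := inab _ (xin i.+1 ni).
    have dx : 0 <= x i.+1 - x i by rewrite subr_ge0 (le_trans xi ci).
    have pcq : x i <= c i <= x i.+1 by rewrite xi ci.
    have main : M * weight y * (x i.+1 - x i) ^+ 2 <= M * weight y * delta * (x i.+1 - x i).
      rewrite expr2 mulrA ler_wpM2r// ler_wpM2l ?mulr_ge0 ?weight_ge0//.
      exact: ltW.
    apply: le_trans (normc_le _) _.
    rewrite Re_add Im_add Re_opp Im_opp Re_add Im_add Re_opp Im_opp Re_mul Im_mul.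
    rewrite /= !mul0r subr0 addr0 -!mulrA mulr_natl mulr2n !mulrA.
    apply: lerD; apply: le_trans main.
      apply: (riemann_step_le p0 pcq q0 (f := fun s => complex.Re (v s y))
        (g := fun s => complex.Re (W s y)) (h := fun s => complex.Re (Z s y))).
      + by move=> s /(vW _ y)[].
      + by move=> s /(WZ _ y)[].
      + by move=> s sab; rewrite (le_trans (Re_le_normc _))//; exact: ZM.
    apply: (riemann_step_le p0 pcq q0 (f := fun s => complex.Im (v s y))
      (g := fun s => complex.Im (W s y)) (h := fun s => complex.Im (Z s y))).
    + by move=> s /(vW _ y)[].
    + by move=> s /(WZ _ y)[].
    + by move=> s sab; rewrite (le_trans (Im_le_normc _))//; exact: ZM.
  rewrite -mulr_sumr (_ : \sum_(i < n) _ = T); last first.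
    transitivity (x n - x 0%N); last by rewrite xn x0 subr0.
    elim: (n) => [|m IH]; first by rewrite big_ord0 subrr.
    by rewrite big_ord_recr/= IH; ring.
  by rewrite le_eqVlt; apply/orP; left; apply/eqP; ring.
have ms : cmeasurable (fun y =>
    \sum_(i < n) (x i.+1 - x i)%:C%C * W (c i) y - (v T y - v 0 y)).
  under eq_fun do rewrite -mulN1r.
  apply: cmeasurableD; last by apply: cmeasurableZ; case: V2.
  apply: (cmeasurable_sum (F := fun i y => (x i.+1 - x i)%:C%C * W (c i) y)) => i ni.
  by apply: cmeasurableZ; case: (W2 _ (cin i ni)).
apply: (@le_lt_trans _ _ (2 * M * T * delta * Num.sqrt (pi / 1))%:E).
  apply: cLnorm2_le => //; first by rewrite !mulr_ge0 ?(ltW delta0).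
  by move=> y; rewrite mul1r; exact: (decay_sqr_le y (bound : decay _ _)).
rewrite lte_fin -deltaE mulrAC mulrC ltr_pM2l//.
by rewrite /D ltrDl.
Qed.

End RiemannSums.

Section DuhamelFormula.
Context {R : realType}.
Local Notation C := R[i].
Local Notation normc := Normc.normc.
Local Notation mu := (@lebesgue_measure R).
Implicit Types (K : (R -> R -> C) -> Prop) (s x y xi : R).

Lemma schwartz_duhamel (a b : R) K (u F ux uxx : R -> R -> C) (T : R) :
  schwartz_family a b K -> K u -> K F -> K ux -> K uxx ->
  (forall s x, a < s < b -> cder (u s) x (ux s x)) ->
  (forall s x, a < s < b -> cder (ux s) x (uxx s x)) ->
  (forall s x, a < s < b -> cder (u ^~ x) s ('i%C * (uxx s x + F s x))) ->
  (forall s, a < s < b -> F s = nonlocal_cubic (u s)) ->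
  a < 0 -> 0 <= T -> T < b -> duhamel u T.
Proof.
move=> SK Ku KF Kux Kuxx u_x ux_x u_t FE a0 T0 Tb.
have N1N1 : -1 * -1 = 1 :> R by rewrite mulrNN mulr1.
have N1 : 1 * 1 = 1 :> R by rewrite mulr1.
have inab s : 0 <= s <= T -> a < s < b.
  by move=> /andP[s0 sT]; rewrite (lt_le_trans a0 s0) (le_lt_trans sT Tb).
have zab : a < 0 < b by rewrite inab// lexx.
have Tab : a < T < b by rewrite inab// lexx T0.
(* The phase (s - T) xi^2 is that of S(T - s); [K2] is the same family brought back to physical
   space. *)
pose K1 := fourier_family a b K (-1) 1 (- T).
have SK1 : schwartz_family a b K1 := schwartz_fourier_family SK N1N1 1 (- T).
pose K2 := fourier_family a b K1 1 0 0.
have SK2 : schwartz_family a b K2 := schwartz_fourier_family SK1 N1 0 0.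
pose lift (f : R -> R -> C) s xi := cis (- ((T - s) * xi ^+ 2)) * fourier (-1) (f s) xi.
have K1lift f : K f -> K1 (lift f).
  move=> Kf; exists f => // s xi _; rewrite /lift; congr (cis _ * _); ring.
have K2f f : K1 f -> K2 (fun s => fourier 1 (f s)).
  by move=> Kf; exists f => // s xi _; rewrite mul0r add0r mul0r cis0 mul1r.
pose evol (f : R -> R -> C) s := free_evolution (T - s) (f s).
have evolE f s y : evol f s y = fconst^-1 * fourier 1 (lift f s) y by [].
have K2evol f : K f -> K2 (evol f).
  by move=> Kf; exact: (schwartz_scale SK2 fconst^-1 (K2f _ (K1lift _ Kf))).
have lift_t s xi : a < s < b -> cder ((lift u) ^~ xi) s ('i%C * lift F s xi).
  move=> sab.
  have dp : is_derive s 1 (fun s => - ((T - s) * xi ^+ 2)) (xi ^+ 2).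
    by apply: is_derive_eq; rewrite /GRing.scale/=; ring.
  have KiF := schwartz_scale SK 'i%C (schwartz_add SK Kuxx KF).
  apply: cder_eq (cderM (cder_cis dp)
    (schwartz_cder_fourier_time SK (-1) xi Ku KiF sab u_t)) _.
  rewrite (schwartz_fourierZ SK _ _ _ (schwartz_add SK Kuxx KF) sab).
  rewrite (schwartz_fourierD SK _ _ Kuxx KF sab).
  have E1 := schwartz_fourier_derivative SK N1N1 xi Ku Kux sab (fun x => u_x s x sab).
  have E2 := schwartz_fourier_derivative SK N1N1 xi Kux Kuxx sab (fun x => ux_x s x sab).
  (* The s-derivative of the phase gives i xi^2 times the transform of [u], which cancels the
     dispersive term i u_xx; only [F] remains. *)
  have E3 : xi%:C%C ^+ 2 * fourier (-1) (u s) xi = - fourier (-1) (uxx s) xi.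
    rewrite expr2 -mulrA E1 mulrCA E2.
    have -> : (-1)%:C%C = -1 :> C by rewrite rmorphN rmorph1.
    have i2 : 'i%C * 'i%C = -1 :> C by rewrite -expr2 sqr_i.
    by rewrite -[RHS]mulN1r -[in RHS]i2; ring.
  rewrite /lift real_complexX.
  rewrite [X in X + _](_ : _ = 'i%C * cis (- ((T - s) * xi ^+ 2)) *
    (xi%:C%C ^+ 2 * fourier (-1) (u s) xi)); last by ring.
  by rewrite E3; ring.
have evol_t s y : a < s < b -> cder ((evol u) ^~ y) s ('i%C * evol F s y).
  move=> sab.
  have KH := schwartz_scale SK1 'i%C (K1lift _ KF).
  have := cderZ fconst^-1 (schwartz_cder_fourier_time SK1 1 y (K1lift _ Ku) KH sab
    (fun r x rab => lift_t r x rab)).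
  move=> h; apply: cder_eq h _.
  by rewrite (schwartz_fourierZ SK1 _ _ _ (K1lift _ KF) sab) evolE mulrCA.
have [Z K2Z evolF_t] := schwartz_d_time SK2 (K2evol _ KF).
have [M ZM] := schwartz_decay SK2 K2Z.
have [L uL] := schwartz_decay SK2 (K2evol _ Ku).
have cu s := schwartz_continuous SK2 (K2evol _ Ku) (s := s).
have evolT : evol u T = u T.
  by rewrite /evol subrr; exact: (free_evolution0 SK Ku Tab).
(* The factor -i makes the derivative in [s] exactly [evol F]; multiplying v(T) - v(0) by i then
   gives u(T) - S(T) u(0). *)
pose v s y := - 'i%C * evol u s y.
have Kv : K2 v := schwartz_scale SK2 (- 'i%C) (K2evol _ Ku).
have [L' vL] := schwartz_decay SK2 Kv.
have vE s y : v s y = - 'i%C * evol u s y by [].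
have evol0 : evol u 0 = free_evolution T (u 0) by rewrite /evol subr0.
have evolF s : evol F s = free_evolution (T - s) (F s) := erefl _.
have v_t s y : a < s < b -> cder (v ^~ y) s (evol F s y).
  move=> sab.
  apply: cder_eq (cderZ (- 'i%C) (evol_t s y sab)) _.
  by rewrite mulrA mulNr -expr2 sqr_i opprK mul1r.
clear evol_t lift_t.
clearbody v evol K2 K1.
exists (evol u 0), (evol F), (fun y => v T y - v 0 y); split.
- by rewrite evol0; exact: (schwartz_is_schrodinger T SK Ku zab).
- move=> s sT; rewrite -FE ?inab// evolF.
  by apply: (schwartz_is_schrodinger _ SK KF); exact: inab.
- apply: (@is_integral_L2_FTC R a b T v (evol F) Z M a0 T0 Tb).
  + move=> s sab; apply: ccontinuous_measurable.
    by apply: (schwartz_continuous SK2 Kv).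
  + move=> s sT.
    have [L2 FL] := schwartz_decay SK2 (K2evol _ KF).
    apply: decay_inL2 (FL s (inab s sT)); apply: ccontinuous_measurable.
    by apply: (schwartz_continuous SK2 (K2evol _ KF)); exact: inab.
  + have KvN := schwartz_scale SK2 (-1) Kv.
    have [L3 vNL] := schwartz_decay SK2 KvN.
    have d := decayD (vL T Tab) (vNL 0 zab).
    have -> : (fun y => v T y - v 0 y) = (fun y => v T y + -1 * v 0 y).
      by apply/funext => y; rewrite mulN1r.
    apply: decay_inL2 d; apply: ccontinuous_measurable; apply: ccontinuousD.
      by apply: (schwartz_continuous SK2 Kv).
    by apply: (schwartz_continuous SK2 KvN).
  + by move=> s y sab; exact: v_t.
  + by move=> s y sab; exact: evolF_t.
  + exact: ZM.
- apply: aeW => y; rewrite !vE -evolT.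
  have i2 : 'i%C * 'i%C = -1 :> C by rewrite -expr2 sqr_i.
  rewrite mulrBr !mulrA !mulrN i2 opprK !mul1r; ring.
Qed.

End DuhamelFormula.

(** * Sobolev norms *)

Section Sobolev.
Context {R : realType}.
Local Notation C := R[i].
Local Notation normc := Normc.normc.
Local Notation mu := (@lebesgue_measure R).
Implicit Types (f g : R -> C) (K : (R -> R -> C) -> Prop) (s x y : R).

Lemma ccontinuous_cintegrable_itv (a b : R) f : ccontinuous f ->
  cintegrable `[a, b] f.
Proof.
move=> [cf1 cf2]; split; apply: continuous_compact_integrable => //.
- exact: segment_compact.
- exact: continuous_subspaceT.
- exact: segment_compact.
- exact: continuous_subspaceT.
Qed.

(** The product f phi vanishes at both ends of an interval containing the support of phi, so its
    derivative integrates to 0 there. *)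
Lemma cder_weak_derivative f g : (forall x, cder f x (g x)) -> ccontinuous g ->
  weak_derivative f g.
Proof.
move=> fg cg phi [dphi [M phi0]].
have cf := cder_continuous fg.
have phi1 x : is_derive x 1 phi (derive1 phi x).
  by rewrite derive1E; apply: DeriveDef => //; exact: (dphi 0%N x).
have cphi : continuous phi.
  by move=> x; apply: differentiable_continuous; apply/derivable1_diffP; exact: (dphi 0%N x).
have cdphi : continuous (derive1 phi).
  by move=> x; apply: differentiable_continuous; apply/derivable1_diffP; exact: (dphi 1%N x).
have dphi0 x : M < `|x| -> derive1 phi x = 0.
  move=> Mx; rewrite derive1E.
  have h : \forall y \near x, phi y = cst 0 y.
    have /cvgr_gt : `|y| @[y --> x] --> `|x| by apply: cvg_norm; exact: cvg_id.
    by move/(_ M Mx); apply: filterS => y; exact: phi0.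
  by rewrite (near_eq_derive _ h)// derive_cst.
(* [M] may be negative; [L] is nonnegative and exceeds [M] strictly, so [phi] vanishes at both
   endpoints as well as outside the interval. *)
pose L := `|M| + 1.
have L0 : 0 <= L by rewrite addr_ge0.
have ML : M < L by rewrite (le_lt_trans (ler_norm M))// ltrDl.
pose I : set R := [set` `[- L, L]].
have out x : x \notin I -> M < `|x|.
  rewrite notin_setE /I/= in_itv/= -ler_norml => /negP; rewrite -ltNge.
  exact: lt_trans.
have toI (h : R -> C) : (forall x, M < `|x| -> h x = 0) -> cintegral setT h = cintegral I h.
  move=> h0; rewrite (cintegral_mkcond I); apply: eq_cintegral => x _.
  by case: ifPn => // /out /h0.
have c1 : ccontinuous (fun x => g x * (phi x)%:C%C).
  by apply: ccontinuousM => //; exact: ccontinuous_real.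
have c2 : ccontinuous (fun x => f x * (derive1 phi x)%:C%C).
  by apply: ccontinuousM => //; exact: ccontinuous_real.
rewrite toI; last by move=> x /dphi0 ->; rewrite mulr0.
rewrite toI; last by move=> x /phi0 ->; rewrite mulr0.
have dF x := cderM (fg x) (cder_real (phi1 x)).
have := cintegral_FTC (_ : - L <= L) (ccontinuousD c1 c2) dF.
rewrite ge0_cp// => /(_ isT).
rewrite !phi0 ?normrN ?(ger0_norm L0)// !mulr0 subr0.
rewrite cintegralD//; try exact: ccontinuous_cintegrable_itv.
by rewrite addrC => /eqP; rewrite addr_eq0 => /eqP.
Qed.

(** Classical derivatives form a weak jet, which bounds the infimum; the square root of a sum of
    squares is then at most the sum. *)
Lemma Hnorm_le k f (D : nat -> R -> C) (c : nat -> R) : D 0%N = f ->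
  (forall j x, (j <= k)%N -> cder (D j) x (D j.+1 x)) ->
  (forall j, (j <= k)%N -> inL2 (D j)) ->
  (forall j, (j <= k)%N -> ccontinuous (D j)) ->
  (forall j, 0 <= c j) ->
  (forall j, (j <= k)%N -> (cLnorm 2%:E (D j) <= (c j)%:E)%E) ->
  (Hnorm k f <= (\sum_(j < k.+1) c j)%:E)%E.
Proof.
move=> D0 dD D2 cD c0 Dc.
have jet : weak_jet k f D.
  split=> // j jk; apply: cder_weak_derivative; last exact: cD.
  by move=> x; apply: dD; exact: ltnW.
have S0 : 0 <= \sum_(j < k.+1) c j by rewrite sumr_ge0.
apply: (@le_trans _ _ ((\sum_(j < k.+1) cLnorm 2%:E (D j) ^+ 2) `^ (2^-1))%E).
  by apply: ereal_inf_lbound; exists D.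
rewrite -[leRHS]/((\sum_(j < k.+1) c j)%:E).
have -> : ((\sum_(j < k.+1) c j)%:E = ((\sum_(j < k.+1) c j) ^+ 2)%:E `^ 2^-1)%E.
  by rewrite poweR_EFin powR12_sqrt ?sqr_ge0// sqrtr_sqr ger0_norm.
have sum0 : (0 <= \sum_(j < k.+1) cLnorm 2%:E (D j) ^+ 2)%E.
  by apply: sume_ge0 => j _; rewrite expe_ge0 ?Lnorm_ge0.
apply: gt0_ler_poweR; first by rewrite invr_ge0.
- by rewrite in_itv/= leey andbT.
- by rewrite in_itv/= leey andbT lee_fin sqr_ge0.
apply: (@le_trans _ _ (\sum_(j < k.+1) (c j ^+ 2)%:E)%E).
  apply: lee_sum => j _; have := Dc j (ltn_ord j : (j <= k)%N).
  have := @Lnorm_ge0 _ _ _ mu 2%:E (fun x => (normc (D j x))%:E).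
  rewrite -/(cLnorm _ _); case: (cLnorm _ _) => [r| |]//=.
  by rewrite !lee_fin => r0 rc; rewrite -expr2 ler_sqr ?nnegrE.
rewrite sumEFin lee_fin.
elim: (k.+1) => [|m IH]; first by rewrite !big_ord0 expr0n.
rewrite !big_ord_recr/= sqrrD -addrA lerD//.
by rewrite lerDr mulrn_wge0// mulr_ge0// sumr_ge0.
Qed.

Section Family.
Variables (a b : R) (K : (R -> R -> C) -> Prop).
Hypothesis SK : schwartz_family a b K.

Lemma schwartz_inL2 (u : R -> R -> C) s : K u -> a < s < b -> inL2 (u s).
Proof.
move=> Ku sab; have [M uM] := schwartz_decay SK Ku.
apply: decay_inL2 (uM s sab); apply: ccontinuous_measurable.
exact: (schwartz_continuous SK Ku sab).
Qed.

Lemma schwartz_inH1 (u : R -> R -> C) s : K u -> a < s < b -> inH 1 (u s).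
Proof.
move=> Ku sab; have [g Kg ug] := schwartz_d_space SK Ku.
exists (fun j => if j is 0 then u s else g s); split => //.
- by case=> [|j] _; apply: schwartz_inL2.
- case=> [|j]// _; apply: cder_weak_derivative; first by move=> x; exact: ug.
  exact: (schwartz_continuous SK Kg sab).
Qed.

(** The mean value theorem in time, once for each component, whence the factor 2. The absolute value
    keeps the constant nonnegative even when []a, b[] is empty. *)
Lemma schwartz_lipschitz (u : R -> R -> C) : K u -> exists2 M, 0 <= M &
  forall s t, a < s < b -> a < t < b -> decay (M * `|s - t|) (u s \- u t).
Proof.
move=> Ku; have [g Kg ug] := schwartz_d_time SK Ku.
have [M gM] := schwartz_decay SK Kg.
exists (2 * `|M|) => // s t.
wlog st : s t / t <= s => [hw|].
  have [ts|st] := leP t s; first exact: hw.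
  move=> sab tab x; rewrite -normcN opprB distrC.
  exact: (hw t s (ltW st) tab sab x).
move=> /andP[as_ sb] /andP[at_ tb] x.
have gM' r : a < r < b -> normc (g r x) <= `|M| * weight x.
  by move=> rab; rewrite (le_trans (gM r rab x))// ler_wpM2r ?weight_ge0 ?ler_norm.
apply: le_trans (normc_le _) _.
rewrite Re_add Im_add Re_opp Im_opp (ger0_norm (_ : 0 <= s - t)) ?subr_ge0//.
have -> : 2 * `|M| * (s - t) * weight x =
    `|M| * weight x * (s - t) + `|M| * weight x * (s - t).
  by ring.
have [|r /andP[tr rs] ->] := MVT_between (f := fun r => complex.Re (u r x))
  (df := fun r => complex.Re (g r x)) at_ st sb.
  by move=> r rab; case: (ug r x rab).
have [|r' /andP[tr' rs'] ->] := MVT_between (f := fun r => complex.Im (u r x))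
  (df := fun r => complex.Im (g r x)) at_ st sb.
  by move=> q qab; case: (ug q x qab).
rewrite !normrM (ger0_norm (_ : 0 <= s - t)) ?subr_ge0//.
apply: lerD; rewrite ler_wpM2r ?subr_ge0//.
  rewrite (le_trans (Re_le_normc _))// gM'//.
  by rewrite (lt_le_trans at_ tr) (le_lt_trans rs sb).
rewrite (le_trans (Im_le_normc _))// gM'//.
by rewrite (lt_le_trans at_ tr') (le_lt_trans rs' sb).
Qed.

Lemma schwartz_continuous_H1 (u : R -> R -> C) t : K u -> a < t < b ->
  Hnorm 1 (u s \- u t) @[s --> t] --> 0%E.
Proof.
move=> Ku tab; have [ux Kux u_x] := schwartz_d_space SK Ku.
have [v Kv ux_x] := schwartz_d_space SK Kux.
have [M M0 uM] := schwartz_lipschitz Ku.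
have [N N0 uxN] := schwartz_lipschitz Kux.
pose P := (M + N) * Num.sqrt (pi / 1).
have near_ab : \forall s \near t, a < s < b.
  move/andP: (tab) => [ta tb]; near=> r; apply/andP; split.
    by near: r; exact: lt_nbhsr.
  by near: r; exact: lt_nbhsl.
have Hge0 f : (0 <= Hnorm 1 f)%E.
  apply: le_ereal_inf_tmp => _ [D _ <-]; exact: poweR_ge0.
have step s : a < s < b -> (Hnorm 1 (u s \- u t)%R <= (P * `|s - t|)%:E)%E.
  move=> sab.
  have dsub (w wx : R -> R -> C) : (forall r x, a < r < b -> cder (w r) x (wx r x)) ->
      forall x, cder (w s \- w t) x ((wx s \- wx t) x).
    move=> h x; have := cderD (h s x sab) (cderZ (-1) (h t x tab)).
    rewrite mulN1r (_ : (fun y => _) = w s \- w t)//.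
    by apply/funext => y; rewrite mulN1r.
  have csub w : K w -> ccontinuous (w s \- w t).
    by move=> /(schwartz_d_space SK)[wx _ /dsub h]; exact: cder_continuous h.
  have Lsub w L : K w -> 0 <= L -> decay (L * `|s - t|) (w s \- w t) ->
      (cLnorm 2%:E (w s \- w t)%R <= (L * `|s - t| * Num.sqrt (pi / 1))%:E)%E.
    move=> Kw L0 wL; apply: cLnorm2_le => //; first by rewrite mulr_ge0.
      by apply: ccontinuous_measurable; exact: csub.
    by move=> x; rewrite mul1r; exact: decay_sqr_le.
  (* The entry beyond 1 is the derivative that [Hnorm_le] asks of [D 1]. *)
  pose D j := if j is 0%N then u s \- u t else if j is 1%N then ux s \- ux t else v s \- v t.
  pose c j := (if j is 0%N then M else N) * `|s - t| * Num.sqrt (pi / 1).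
  apply: le_trans.
    apply: (@Hnorm_le 1 _ D c) => //.
    - by case=> [|[|j]]// x _; exact: dsub.
    - case=> [|[|j]]// _.
        by apply: decay_inL2 (uM s t sab tab); apply: ccontinuous_measurable; exact: csub.
      by apply: decay_inL2 (uxN s t sab tab); apply: ccontinuous_measurable; exact: csub.
    - by case=> [|[|j]]// _; exact: csub.
    - by case=> [|j]; rewrite /c !mulr_ge0 ?sqrtr_ge0.
    - by case=> [|[|j]]// _; apply: Lsub => //; [exact: uM|exact: uxN].
  rewrite !big_ord_recr big_ord0/= add0r lee_fin /c /P.
  by rewrite le_eqVlt; apply/orP; left; apply/eqP; ring.
apply: (@squeeze_cvge _ _ _ _ (cst 0%E) _ (fun s => (P * `|s - t|)%:E)).
- by apply: filterS near_ab => s sab; rewrite Hge0 step.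
- exact: cvg_cst.
- apply: cvg_EFin; first exact: nearW.
  have : (P * `|s - t|) @[s --> t] --> P * `|t - t|.
    apply: cvgMl_tmp; apply: (@cvg_norm _ R); apply: (@cvgB _ R); first exact: cvg_id.
    exact: cvg_cst.
  by rewrite subrr normr0 mulr0.
Unshelve. all: end_near. Qed.

End Family.
End Sobolev.

(** * The nonlocal soliton *)

Section SolitonFamily.
Context {R : realType}.
Local Notation C := R[i].
Local Notation normc := Normc.normc.
Implicit Types (s x : R).

Variables (al t0 : R).
Hypotheses (al0 : 0 < al) (t00 : 0 < t0) (t0pi : 3 * al ^+ 2 * t0 < pi).

Definition soliton_denom s x : C :=
  1 + cis (- (3 * al ^+ 2) * s) * (expR (al * x))%:C%C ^+ 3.

Definition soliton_atom (n m j p : nat) (k : R) s x : C :=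
  s%:C%C ^+ n * x%:C%C ^+ m * (cis (k * s) * (expR (al * x))%:C%C ^+ j *
    (soliton_denom s x)^-1 ^+ p).

Inductive soliton_family : (R -> R -> C) -> Prop :=
| SolitonAtom n m j p k : (0 < j < 3 * p)%N -> soliton_family (soliton_atom n m j p k)
| SolitonAdd f g : soliton_family f -> soliton_family g ->
    soliton_family (fun s x => f s x + g s x)
| SolitonScale (c : C) f : soliton_family f -> soliton_family (fun s x => c * f s x).

(** For |s| < t0 the angle stays below th = 3 al^2 t0 < pi. The constant is k = cos(th/2): the ratio
    |1 + B e^{i th}| / (1 + B) is least at B = 1, where it equals cos(th/2). *)
Lemma soliton_denom_ge : exists2 k : R, 0 < k &
  forall s x, - t0 < s < t0 -> k * (1 + expR (al * x) ^+ 3) <= normc (soliton_denom s x).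
Proof.
pose th := 3 * al ^+ 2 * t0.
have th0 : 0 < th by rewrite !mulr_gt0.
have c0 : 0 < (1 + cos th) / 2.
  rewrite divr_gt0// -ltrBlDl sub0r -cospi ltr_cos ?in_itv/= ?pi_ge0 ?lexx//.
  by rewrite (ltW th0) (ltW t0pi).
exists (Num.sqrt ((1 + cos th) / 2)); first by rewrite sqrtr_gt0.
move=> s x st; set B := expR (al * x) ^+ 3.
have B0 : 0 < B by rewrite exprn_gt0// expR_gt0.
set y := - (3 * al ^+ 2) * s.
have cy : cos th <= cos y.
  have yth : `|y| <= th.
    have a0 : 0 <= 3 * al ^+ 2 by rewrite mulr_ge0 ?sqr_ge0.
    rewrite /y normrM normrN (ger0_norm a0); apply: ler_wpM2l => //.
    by rewrite ler_norml; case/andP: st => /ltW -> /ltW ->.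
  rewrite -(cos_norm y) leNgt ltr_cos ?in_itv/= ?normr_ge0 ?(ltW th0) ?(ltW t0pi)//.
    by rewrite -leNgt.
  by rewrite (le_trans yth (ltW t0pi)).
rewrite -(@ler_pXn2r _ 2)// ?nnegrE ?normc_ge0 ?mulr_ge0 ?sqrtr_ge0 ?addr_ge0 ?(ltW B0)//.
rewrite exprMn sqr_sqrtr ?(ltW c0)// normc_sqr /soliton_denom -real_complexX -/B -/y.
rewrite Re_add Im_add Re_mul Im_mul /= !mulr0 subr0 add0r add0r.
have := cos2Dsin2 y; move: (sin y) => sn E.
have -> : (1 + cos y * B) ^+ 2 + (sn * B) ^+ 2 =
    1 + 2 * cos y * B + B ^+ 2 * (cos y ^+ 2 + sn ^+ 2) by ring.
rewrite E mulr1.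
(* The difference is [2 (cos y - cos th) B + (1 - cos th) / 2 * (1 - B)^2]. *)
have h1 : 0 <= (1 - cos th) * (1 - B) ^+ 2.
  by rewrite mulr_ge0 ?sqr_ge0// subr_ge0 cos_le1.
have h2 : 0 <= (cos y - cos th) * B by rewrite mulr_ge0 ?subr_ge0 ?(ltW B0).
by move: h1 h2; move: (cos y) (cos th) => c d h1 h2; nra.
Qed.

Lemma soliton_denom_neq0 s x : - t0 < s < t0 -> soliton_denom s x != 0.
Proof.
move=> st; have [k k0 /(_ s x st) h] := soliton_denom_ge.
by apply: contraTneq h => ->; rewrite Normc.normc0 -ltNge mulr_gt0//.
Qed.

Let is_derive_expR_scaled x : is_derive x 1 (fun x => expR (al * x)) (al * expR (al * x)).
Proof.
have h : is_derive x 1 (fun y => al * y) al.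
  by apply: is_derive_eq; rewrite /GRing.scale/= mulr1.
by apply: is_derive_eq (is_derive1_comp (is_derive_expR _) h) _; rewrite mulrC.
Qed.

Let cder_pow_id n x : cder (fun x : R => x%:C%C ^+ n) x (n%:R * x%:C%C ^+ n.-1).
Proof.
have h : cder (fun x : R => x%:C%C) x (1%:C%C) by apply: cder_real; exact: is_derive_id.
by apply: cder_eq (cderX n h) _; rewrite mulr1.
Qed.

Let cder_expR_pow j x : cder (fun x => (expR (al * x))%:C%C ^+ j) x
  (j%:R * al%:C%C * (expR (al * x))%:C%C ^+ j).
Proof.
apply: cder_eq (cderX j (cder_real (is_derive_expR_scaled x))) _.
case: j => [|j]; first by rewrite !mul0r.
by rewrite real_complexM exprS /=; ring.
Qed.

Let cisk3 k s : cis ((k - 3 * al ^+ 2) * s) = cis (k * s) * cis (- (3 * al ^+ 2) * s) :> C.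
Proof. by rewrite -cisD mulrDl. Qed.

(** A derivative falling on the denominator raises [p] by 1 and [j] by 3 and shifts the frequency.
    When [m = 0] the coefficient [m%:R] cancels the term where [m.-1] is truncated to 0. *)
Lemma cder_soliton_atom_space n m j p k s x : - t0 < s < t0 ->
  cder (soliton_atom n m j p k s) x
    (m%:R * soliton_atom n m.-1 j p k s x + j%:R * al%:C%C * soliton_atom n m j p k s x
     - 3 * al%:C%C * p%:R * soliton_atom n m (j + 3) p.+1 (k - 3 * al ^+ 2) s x).
Proof.
move=> st; have d0 := soliton_denom_neq0 x st.
have dD : cder (soliton_denom s) x
    (3 * al%:C%C * cis (- (3 * al ^+ 2) * s) * (expR (al * x))%:C%C ^+ 3).
  apply: cder_eq (cderD (cder_cst 1 x) (cderZ _ (cder_expR_pow 3 x))) _.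
  by rewrite add0r; ring.
have dDp := cderX p (cderV d0 dD).
apply: cder_eq (cderM (cderZ (s%:C%C ^+ n) (cder_pow_id m x))
  (cderM (cderZ (cis (k * s)) (cder_expR_pow j x)) dDp)) _.
rewrite /soliton_atom cisk3 exprD.
move: (soliton_denom s x) d0 => D d0.
case: p {dDp} => [|p]; first by ring.
by rewrite succnK -exprVn !exprS; ring.
Qed.

Lemma cder_soliton_atom_time n m j p k s x : - t0 < s < t0 ->
  cder ((soliton_atom n m j p k) ^~ x) s
    (n%:R * soliton_atom n.-1 m j p k s x + k%:C%C * 'i%C * soliton_atom n m j p k s x
     + 3 * al%:C%C ^+ 2 * 'i%C * p%:R * soliton_atom n m (j + 3) p.+1 (k - 3 * al ^+ 2) s x).
Proof.
move=> st; have d0 := soliton_denom_neq0 x st.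
have dcis (q : R) : cder (fun s => cis (q * s)) s (q%:C%C * 'i%C * cis (q * s)).
  by apply: cder_cis; apply: is_derive_eq; rewrite /GRing.scale/= mulr1.
have dD : cder (soliton_denom ^~ x) s
    (- (3 * al%:C%C ^+ 2) * 'i%C * cis (- (3 * al ^+ 2) * s) * (expR (al * x))%:C%C ^+ 3).
  apply: cder_eq (cderD (cder_cst 1 s)
    (cderM (dcis _) (cder_cst ((expR (al * x))%:C%C ^+ 3) s))) _.
  have -> : (- (3 * al ^+ 2))%:C%C = - (3 * al%:C%C ^+ 2) :> C.
    by rewrite rmorphN/= real_complexM real_complexX real_complex_nat.
  by rewrite /cst; ring.
have dDp := cderX p (cderV (f := soliton_denom ^~ x) d0 dD).
apply: cder_eq (cderM (cderM (cder_pow_id n s) (cder_cst (x%:C%C ^+ m) s))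
  (cderM (cderM (dcis k) (cder_cst ((expR (al * x))%:C%C ^+ j) s)) dDp)) _.
rewrite /soliton_atom /cst; cbv beta; rewrite cisk3 exprD.
move: (soliton_denom s x) d0 => D d0.
case: p {dDp} => [|p]; first by ring.
by rewrite succnK -exprVn !exprS; ring.
Qed.

End SolitonFamily.

(** * Exponential decay and closure of the soliton family *)

Section SolitonSchwartz.
Context {R : realType}.
Local Notation C := R[i].
Local Notation normc := Normc.normc.
Implicit Types (s x : R).

Lemma expr_le_expR (y : R) n : 0 <= y -> y ^+ n <= n`!%:R * expR y.
Proof.
move=> y0; case: n => [|n].
  by rewrite expr0 fact0 mul1r -expR0 ler_expR.
rewrite -ler_pdivrMl ?ltr0n ?fact_gt0// mulrC.
by rewrite (le_trans _ (expR_ge1Dxn n y0))// lerDr.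
Qed.

(** The bound of each power against the exponential, at [m] and at [m.+2], added up: the two powers
    together carry the factor 1 + x^2. *)
Lemma expr_expR_decay (al : R) m : 0 < al -> exists2 M, 0 <= M &
  forall x, `|x| ^+ m * expR (- (al * `|x|)) <= M * weight x.
Proof.
move=> al0; pose c n : R := n`!%:R / al ^+ n.
have h n x : `|x| ^+ n * expR (- (al * `|x|)) <= c n.
  have := @expr_le_expR (al * `|x|) n (mulr_ge0 (ltW al0) (normr_ge0 x)).
  rewrite expRN ler_pdivrMr ?expR_gt0// exprMn /c mulrAC ler_pdivlMr ?exprn_gt0//.
  by rewrite mulrC.
exists (c m + c m.+2); first by rewrite addr_ge0 ?divr_ge0 ?exprn_ge0 ?(ltW al0).
move=> x; rewrite /weight ler_pdivlMr ?oneDsqr_pos//.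
apply: le_trans (lerD (h m x) (h m.+2 x)).
by rewrite /oneDsqr -(real_normK (num_real x)) !exprS; lra.
Qed.

(** The condition on [j] at work: [0 < j] gives decay as b tends to 0, and [j < 3 * p] gives it as b
    tends to infinity, where the denominator dominates b^{3p}. For b = e^{al x} the minimum is
    e^{-al |x|}. *)
Lemma expr_ratio_le (b : R) j p : 0 < b -> (0 < j < 3 * p)%N ->
  b ^+ j * (1 + b ^+ 3) ^- p <= Num.min b b^-1.
Proof.
move=> b0 /andP[j0 jp]; have b3 : 0 < b ^+ 3 by rewrite exprn_gt0.
have d1 : 1 <= (1 + b ^+ 3) ^+ p by rewrite exprn_ege1// lerDl ltW.
rewrite le_min; apply/andP; split; rewrite ler_pdivrMr ?(lt_le_trans ltr01 d1)//.
- have [b1|b1] := leP b 1.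
    rewrite (@le_trans _ _ b)//; last by rewrite ler_peMr ?(ltW b0).
    by rewrite -[leRHS]expr1 ler_wiXn2l ?(ltW b0).
  rewrite (@le_trans _ _ (b ^+ (3 * p)))//; first by rewrite ler_weXn2l ?(ltW b1)// ltnW.
  rewrite exprM (@le_trans _ _ ((1 + b ^+ 3) ^+ p))//.
    by rewrite lerXn2r ?nnegrE ?addr_ge0 ?(ltW b3)// lerDr.
  by rewrite ler_peMl ?(ltW b1) ?(le_trans ler01 d1).
- rewrite ler_pdivlMl// -exprS.
  have [b1|b1] := leP b 1.
    by rewrite (le_trans _ d1)// exprn_ile1 ?(ltW b0).
  rewrite (@le_trans _ _ (b ^+ (3 * p)))//; first by rewrite ler_weXn2l ?(ltW b1).
  by rewrite exprM lerXn2r ?nnegrE ?addr_ge0 ?(ltW b3)// lerDr.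
Qed.

Variables (al t0 : R).
Hypotheses (al0 : 0 < al) (t00 : 0 < t0) (t0pi : 3 * al ^+ 2 * t0 < pi).

Local Notation atom := (soliton_atom al).
Local Notation family := (soliton_family al).

Lemma decay_soliton_atom n m j p k : (0 < j < 3 * p)%N ->
  exists M, forall s, - t0 < s < t0 -> decay M (atom n m j p k s).
Proof.
move=> jp; have [e e0 De] := soliton_denom_ge al0 t00 t0pi.
have [M M0 Mx] := expr_expR_decay m al0.
exists (t0 ^+ n * (e ^- p * M)) => s st x.
rewrite /soliton_atom !Normc.normcM !normcX !normc_real normc_cis mul1r.
rewrite -!mulrA; apply: ler_pM; rewrite ?exprn_ge0 ?mulr_ge0 ?normc_ge0//.
  by rewrite exprn_ge0 ?normc_ge0.
  by rewrite lerXn2r ?nnegrE ?(ltW t00)// ler_norml; case/andP: st => /ltW -> /ltW ->.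
rewrite Normc.normcV (ger0_norm (expR_ge0 _)).
set b := expR (al * x); have b0 : 0 < b by exact: expR_gt0.
have B0 : 0 < 1 + b ^+ 3 by rewrite ltr_wpDr ?exprn_ge0 ?(ltW b0).
have D0 : 0 < e * (1 + b ^+ 3) by rewrite mulr_gt0.
apply: (@le_trans _ _ (`|x| ^+ m * (b ^+ j * (e * (1 + b ^+ 3)) ^- p))).
  apply: ler_wpM2l; first exact: exprn_ge0.
  apply: ler_wpM2l; first by rewrite exprn_ge0 ?(ltW b0).
  rewrite exprVn lef_pV2 ?posrE ?exprn_gt0 ?(lt_le_trans D0 (De s x st))//.
  by rewrite lerXn2r ?nnegrE ?normc_ge0 ?(ltW D0)// De.
have -> : `|x| ^+ m * (b ^+ j * (e * (1 + b ^+ 3)) ^- p) =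
    e ^- p * (`|x| ^+ m * (b ^+ j * (1 + b ^+ 3) ^- p)).
  by rewrite exprMn invfM; ring.
apply: ler_wpM2l; first by rewrite invr_ge0 exprn_ge0 ?(ltW e0).
apply: le_trans (Mx x); apply: ler_wpM2l; first exact: exprn_ge0.
apply: le_trans (expr_ratio_le b0 jp) _.
have [x0|x0] := leP 0 x; rewrite ge_min; apply/orP; [right|left].
  by rewrite (ger0_norm x0) expRN.
by rewrite (ltr0_norm x0) mulrN opprK.
Qed.

Lemma schwartz_soliton_family : schwartz_family (- t0) t0 family.
Proof.
split.
- exact: SolitonAdd.
- exact: SolitonScale.
- move=> f; elim => [n m j p k jp|f1 g1 _ h1 _ h2|c f1 _ h1].
  + rewrite (_ : (fun s x => _) = atom n.+1 m j p k); first exact: SolitonAtom.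
    by apply/funext => s; apply/funext => x; rewrite /soliton_atom exprS !mulrA.
  + rewrite (_ : (fun s x => _) = fun s x => s%:C%C * f1 s x + s%:C%C * g1 s x).
      exact: SolitonAdd.
    by apply/funext => s; apply/funext => x; rewrite mulrDr.
  + rewrite (_ : (fun s x => _) = fun s x => c * (s%:C%C * f1 s x)).
      exact: SolitonScale.
    by apply/funext => s; apply/funext => x; rewrite mulrCA.
- move=> f; elim => [n m j p k jp|f1 g1 _ h1 _ h2|c f1 _ h1].
  + rewrite (_ : (fun s x => _) = atom n m.+1 j p k); first exact: SolitonAtom.
    by apply/funext => s; apply/funext => x; rewrite /soliton_atom exprS; ring.
  + rewrite (_ : (fun s x => _) = fun s x => x%:C%C * f1 s x + x%:C%C * g1 s x).
      exact: SolitonAdd.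
    by apply/funext => s; apply/funext => x; rewrite mulrDr.
  + rewrite (_ : (fun s x => _) = fun s x => c * (x%:C%C * f1 s x)).
      exact: SolitonScale.
    by apply/funext => s; apply/funext => x; rewrite mulrCA.
- move=> f; elim => [n m j p k jp|f1 g1 _ [h1 K1 d1] _ [h2 K2 d2]|c f1 _ [h1 K1 d1]].
  + exists (fun s x => m%:R * atom n m.-1 j p k s x + j%:R * al%:C%C * atom n m j p k s x
       + - (3 * al%:C%C * p%:R) * atom n m (j + 3) p.+1 (k - 3 * al ^+ 2) s x).
      apply: SolitonAdd; last by apply: SolitonScale; apply: SolitonAtom; lia.
      by apply: SolitonAdd; apply: SolitonScale; exact: SolitonAtom.
    move=> s x st; apply: cder_eq (cder_soliton_atom_space al0 t00 t0pi _ _ _ _ _ _ st) _.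
    by rewrite mulNr.
  + exists (fun s x => h1 s x + h2 s x); first exact: SolitonAdd.
    by move=> s x st; apply: cderD; [exact: d1|exact: d2].
  + exists (fun s x => c * h1 s x); first exact: SolitonScale.
    by move=> s x st; apply: cderZ; exact: d1.
- move=> f; elim => [n m j p k jp|f1 g1 _ [h1 K1 d1] _ [h2 K2 d2]|c f1 _ [h1 K1 d1]].
  + exists (fun s x => n%:R * atom n.-1 m j p k s x + k%:C%C * 'i%C * atom n m j p k s x
       + 3 * al%:C%C ^+ 2 * 'i%C * p%:R * atom n m (j + 3) p.+1 (k - 3 * al ^+ 2) s x).
      apply: SolitonAdd; last by apply: SolitonScale; apply: SolitonAtom; lia.
      by apply: SolitonAdd; apply: SolitonScale; exact: SolitonAtom.
    by move=> s x st; exact: (cder_soliton_atom_time al0 t00 t0pi).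
  + exists (fun s x => h1 s x + h2 s x); first exact: SolitonAdd.
    by move=> s x st; apply: cderD; [exact: d1|exact: d2].
  + exists (fun s x => c * h1 s x); first exact: SolitonScale.
    by move=> s x st; apply: cderZ; exact: d1.
- move=> f; elim => [n m j p k jp|f1 g1 _ [M1 d1] _ [M2 d2]|c f1 _ [M1 d1]].
  + exact: decay_soliton_atom.
  + by exists (M1 + M2) => s st; apply: decayD; [exact: d1|exact: d2].
  + by exists (normc c * M1) => s st; apply: decayZ; exact: d1.
Qed.

End SolitonSchwartz.

(** * The soliton: equation, blow-up and size at time 0 *)

Section SolitonSolution.
Context {R : realType}.
Local Notation C := R[i].
Local Notation normc := Normc.normc.
Local Notation mu := (@lebesgue_measure R).
Implicit Types (s t x al : R).

Lemma conjcM (z w : C) : (z * w)^*%C = z^*%C * w^*%C.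
Proof. exact: rmorphM. Qed.

Lemma conjcD (z w : C) : (z + w)^*%C = z^*%C + w^*%C.
Proof. exact: rmorphD. Qed.

Lemma conjcX (z : C) n : (z ^+ n)^*%C = z^*%C ^+ n.
Proof. exact: rmorphXn. Qed.

(* The soliton [c e^{a x + i a^2 t} / (1 + e^{(a+b) x + i (a^2 - b^2) t})] of the
   focusing NLS, [c^2 = 2 (a + b)^2], for [a = al] and [b = 2 al]. *)
Definition soliton_amplitude al : R := 3 * Num.sqrt 2 * al.

Definition soliton al s x : C :=
  (soliton_amplitude al)%:C%C * soliton_atom al 0 0 1 1 (al ^+ 2) s x.

Lemma amplitude_sqr al : (soliton_amplitude al)%:C%C ^+ 2 = 18 * al%:C%C ^+ 2 :> C.
Proof.
rewrite -real_complexX /soliton_amplitude !exprMn sqr_sqrtr ?ler0n// -natrX -natrM.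
by rewrite real_complexM real_complex_nat real_complexX.
Qed.

Section Fixed.
Variables (al t0 : R).
Hypotheses (al0 : 0 < al) (t00 : 0 < t0) (t0pi : 3 * al ^+ 2 * t0 < pi).

Local Notation a := (soliton_amplitude al)%:C%C.
Local Notation K := (soliton_family al).
Local Notation k1 := (al ^+ 2).
Local Notation k2 := (al ^+ 2 - 3 * al ^+ 2).
Local Notation atom := (soliton_atom al 0 0).

Lemma soliton_nonlocal_cubic s : - t0 < s < t0 ->
  nonlocal_cubic (soliton al s) = fun x => a ^+ 3 * atom (1 + 3) 3 k2 s x.
Proof.
move=> st; apply/funext => x.
have d0 := soliton_denom_neq0 al0 t00 t0pi x st.
have d0' := soliton_denom_neq0 al0 t00 t0pi (- x) st.
rewrite /nonlocal_cubic /soliton /soliton_atom !expr0 !mul1r !expr1.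
set z := cis (k1 * s); set w := cis (- (3 * al ^+ 2) * s).
have -> : cis (k2 * s) = z * w by rewrite -cisD -mulrDl.
pose b : C := (expR (al * x))%:C%C.
have b0 : b != 0 by rewrite eq_complex/= negb_and gt_eqF ?expR_gt0.
have z0 : z != 0 := cis_neq0 _.
have w0 : w != 0 := cis_neq0 _.
have bN : (expR (al * - x))%:C%C = b^-1 by rewrite mulrN expRN fmorphV.
have zc : z^*%C = z^-1.
  by apply: (mulIf z0); rewrite mulVf// /z conj_cis cisN_cis.
have wc : w^*%C = w^-1.
  by apply: (mulIf w0); rewrite mulVf// /w conj_cis cisN_cis.
have bc : b^*%C = b by rewrite /b conjc_real.
(* Here [b] is e^{al x}, and reflecting and conjugating inverts the second term [w * b ^+ 3] of the
   denominator. Hence the conjugate of u(s,-x) has numerator proportional to b^2: it is the partner,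
   with the two rates exchanged. *)
have Dc : (soliton_denom al s (- x))^*%C = soliton_denom al s x / (w * b ^+ 3).
  rewrite /soliton_denom bN -/w -/b conjcD conjc1 conjcM conjcX conjc_inv wc bc.
  by field; rewrite b0 w0.
rewrite bN !conjcM conjc_real zc !conjc_inv bc -/b.
rewrite [X in _ * X](_ : _ =
  (w * b ^+ 3) / soliton_denom al s x * (a * (z^-1 * b^-1))); last first.
  by rewrite Dc; field; rewrite ?d0 ?b0 ?w0 ?z0.
by rewrite exprVn; field; rewrite ?d0 ?b0 ?w0 ?z0.
Qed.

Lemma soliton_in_family : K (soliton al).
Proof. by apply: SolitonScale; exact: SolitonAtom. Qed.

Lemma soliton_duhamel T : 0 <= T < t0 -> duhamel (soliton al) T.
Proof.
move=> /andP[T0 Tt0].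
pose ux s x := a * (al%:C%C * atom 1 1 k1 s x + - (3 * al%:C%C) * atom (1 + 3) 2 k2 s x).
pose uxx s x := a * (al%:C%C ^+ 2 * atom 1 1 k1 s x
  + - (15 * al%:C%C ^+ 2) * atom (1 + 3) 2 k2 s x
  + 18 * al%:C%C ^+ 2 * atom (1 + 3 + 3) 3 (k2 - 3 * al ^+ 2) s x).
apply: (schwartz_duhamel (a := - t0) (b := t0) (K := K)
  (F := fun s x => a ^+ 3 * atom (1 + 3) 3 k2 s x) (ux := ux) (uxx := uxx)
  _ _ _ _ _ _ _ _ _ _ T0 Tt0).
- exact: schwartz_soliton_family.
- exact: soliton_in_family.
- by apply: SolitonScale; exact: SolitonAtom.
- apply: SolitonScale; apply: SolitonAdd; apply: SolitonScale; exact: SolitonAtom.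
- apply: SolitonScale; apply: SolitonAdd; last by apply: SolitonScale; exact: SolitonAtom.
  by apply: SolitonAdd; apply: SolitonScale; exact: SolitonAtom.
- move=> s x st.
  apply: cder_eq (cderZ a (cder_soliton_atom_space al0 t00 t0pi 0 0 1 1 k1 x st)) _.
  by rewrite /ux; ring.
- move=> s x st.
  apply: cder_eq (cderZ a (cderD
    (cderZ al%:C%C (cder_soliton_atom_space al0 t00 t0pi 0 0 1 1 k1 x st))
    (cderZ (- (3 * al%:C%C)) (cder_soliton_atom_space al0 t00 t0pi 0 0 (1 + 3) 2 k2 x st)))) _.
  by rewrite /uxx; ring.
- move=> s x st.
  apply: cder_eq (cderZ a (cder_soliton_atom_time al0 t00 t0pi 0 0 1 1 k1 x st)) _.
  (* This is 1 = (1 + w b^3) / D, for D the denominator. The atoms with p = 3 in [uxx] and in the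
     cubic term both have coefficient 18 al^2, so they merge into one with p = 2, and -15 + 18 = 3
     is the coefficient in the time derivative. This fixes the squared amplitude as 18 al^2. *)
  have E : atom (1 + 3) 2 k2 s x =
      atom (1 + 3 + 3) 3 (k2 - 3 * al ^+ 2) s x + atom (1 + 3) 3 k2 s x.
    have d0 := soliton_denom_neq0 al0 t00 t0pi x st.
    rewrite /soliton_atom.
    have -> : cis ((k2 - 3 * al ^+ 2) * s) = cis (k2 * s) * cis (- (3 * al ^+ 2) * s) :> C.
      by rewrite -cisD -mulrDl.
    move: (mulVf d0); rewrite {2}/soliton_denom.
    move: (soliton_denom al s x)^-1 => D; rewrite mulrDr mulr1 => D1.
    rewrite -[in LHS](mul1r (D ^+ 2)) -[in LHS]D1 !exprD !expr0; ring.
  have a3 : a ^+ 3 = a * (18 * al%:C%C ^+ 2) :> C by rewrite exprS amplitude_sqr.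
  rewrite /uxx a3 E real_complexX; ring.
- by move=> s st; rewrite soliton_nonlocal_cubic.
- by rewrite oppr_lt0.
Qed.

End Fixed.

(** The estimates are uniform only away from the blow-up time, so each [t] gets its own interval,
    ending midway between [t] and that time. *)
Lemma soliton_time_interval al t : 0 < al -> 0 <= t < pi / (3 * al ^+ 2) ->
  exists t0, [/\ 0 < t0, 3 * al ^+ 2 * t0 < pi & t < t0].
Proof.
move=> al0 /andP[t_ge0 tT]; have c0 : 0 < 3 * al ^+ 2 by rewrite mulr_gt0 ?exprn_gt0.
exists ((t + pi / (3 * al ^+ 2)) / 2); split.
- by rewrite divr_gt0// ltr_wpDl// divr_gt0 ?pi_gt0.
- by rewrite mulrC -ltr_pdivlMr//; move: tT; move: (pi / _) => T; lra.
- by move: tT; move: (pi / _) => T; lra.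
Qed.

Lemma soliton_is_solution al : 0 < al -> is_solution (pi / (3 * al ^+ 2)) (soliton al).
Proof.
move=> al0; split=> t tT; have [t0 [t00 t0pi tt0]] := soliton_time_interval al0 tT.
- have tab : - t0 < t < t0.
    by case/andP: tT => t_ge0 _; rewrite tt0 andbT (lt_le_trans _ t_ge0)// oppr_lt0.
  have SK := schwartz_soliton_family al0 t00 t0pi; split.
    exact: (schwartz_inH1 SK (soliton_in_family al) tab).
  exact: (schwartz_continuous SK (soliton_in_family al) tab).
- have tab : - t0 < t < t0.
    by case/andP: tT => t_ge0 _; rewrite tt0 andbT (lt_le_trans _ t_ge0)// oppr_lt0.
  have SK := schwartz_soliton_family al0 t00 t0pi.
  apply: cvg_within_filter.
  exact: (schwartz_continuous_H1 SK (soliton_in_family al) tab).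
- apply: (soliton_duhamel al0 t00 t0pi); case/andP: tT => -> _; exact: tt0.
Qed.

Lemma normc_soliton0 al t : normc (soliton al t 0) =
  `|soliton_amplitude al| / normc (1 + cis (- (3 * al ^+ 2) * t) : C).
Proof.
rewrite /soliton /soliton_atom /soliton_denom mulr0 expR0 rmorph1.
rewrite !expr0 !expr1n !mulr1 !mul1r expr1.
by rewrite !Normc.normcM Normc.normcV normc_cis normc_real mul1r.
Qed.

(** At x = 0 the squared modulus of the denominator is 2 + 2 cos(3 al^2 t), positive before the
    final time and tending to 0 there. *)
Lemma soliton_blowup al : 0 < al ->
  normc (soliton al t 0) @[t --> (pi / (3 * al ^+ 2))^'-] --> +oo.
Proof.
move=> al0; set T := pi / (3 * al ^+ 2).
have c0 : 0 < 3 * al ^+ 2 by rewrite mulr_gt0 ?exprn_gt0.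
have T0 : 0 < T by rewrite divr_gt0 ?pi_gt0.
pose d t := normc (1 + cis (- (3 * al ^+ 2) * t) : C).
have amp0 : 0 < soliton_amplitude al by rewrite !mulr_gt0 ?sqrtr_gt0.
have dE t : d t ^+ 2 = 2 + 2 * cos (3 * al ^+ 2 * t).
  rewrite /d normc_sqr Re_add Im_add/= add0r mulNr cosN sinN sqrrN.
  by have := cos2Dsin2 (3 * al ^+ 2 * t); move: (sin _) (cos _) => u v; lra.
have dpos t : 0 <= t -> t < T -> 0 < d t.
  move=> t_ge0 tT; rewrite lt_neqAle normc_ge0 andbT eq_sym -sqrf_eq0 dE.
  have : cos pi < cos (3 * al ^+ 2 * t).
    have h : 3 * al ^+ 2 * t < pi by rewrite mulrC -ltr_pdivlMr.
    rewrite ltr_cos ?in_itv/= ?pi_ge0 ?lexx//.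
    by rewrite mulr_ge0 ?(ltW c0)// (ltW h).
  by rewrite cospi => h; rewrite gt_eqF//; lra.
have dcvg : d t @[t --> T^'-] --> 0.
  apply: cvg_at_left_filter.
  have -> : d = Num.sqrt \o (fun t => 2 + 2 * cos (3 * al ^+ 2 * t)).
    by apply/funext => t; rewrite /= -dE sqrtr_sqr ger0_norm ?normc_ge0.
  have -> : 0 = Num.sqrt (2 + 2 * cos (3 * al ^+ 2 * T)) :> R.
    have -> : 3 * al ^+ 2 * T = pi by rewrite /T mulrC divfK ?gt_eqF.
    by rewrite cospi mulrN1 subrr sqrtr0.
  apply: (cvg_comp (fun t => 2 + 2 * cos (3 * al ^+ 2 * t)) Num.sqrt); last first.
    exact: sqrt_continuous.
  apply: cvgD; first exact: cvg_cst.
  apply: cvgMl_tmp; apply: (cvg_comp (fun t => 3 * al ^+ 2 * t) cos); last first.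
    exact: continuous_cos.
  by apply: cvgMl_tmp; exact: cvg_id.
apply/cvgryPge => A.
(* Once the denominator is below this threshold the quotient exceeds [|A| + 1], whatever the sign of
   [A]. *)
have e0 : 0 < soliton_amplitude al / (`|A| + 1) by rewrite divr_gt0// ltr_wpDl.
near=> t; rewrite normc_soliton0 (ger0_norm (ltW amp0)) -/(d t).
have t_ge0 : 0 <= t by near: t; exact: nbhs_left_ge.
have tT : t < T by near: t; exact: nbhs_left_lt.
have dt0 := dpos t t_ge0 tT.
rewrite ler_pdivlMr//.
have : d t < soliton_amplitude al / (`|A| + 1) by near: t; exact: (cvgr_lt 0).
rewrite ltr_pdivlMr ?ltr_wpDl// => h.
have := ler_norm A; have := normr_ge0 A; move: `|A| h => B h B0 AB.
have : A * d t <= B * d t by rewrite ler_wpM2r// ltW.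
lra.
Unshelve. all: end_near. Qed.

(** If the modulus at [x] exceeded the essential supremum it would do so, by continuity, on an
    interval around [x], which has positive measure. *)
Lemma cLnormy_ge (f : R -> C) x : ccontinuous f ->
  ((normc (f x))%:E <= cLnorm +oo%E f)%E.
Proof.
move=> [cf1 cf2]; rewrite /cLnorm unlock /=.
(* The norm of exponent +oo is defined by cases on whether the whole space has positive measure. *)
have -> : (0 < mu setT)%E by rewrite -set_itvNyy lebesgue_measure_itv/= addye.
rewrite leNgt; apply/negP; set L := ess_sup_inf.ess_sup _ _ => Lf.
have cn : (fun y => normc (f y)) @ x --> normc (f x).
  have -> : (fun y => normc (f y)) = Num.sqrt \o
      (fun y => complex.Re (f y) ^+ 2 + complex.Im (f y) ^+ 2).
    by apply/funext => y /=; rewrite -normc_sqr sqrtr_sqr ger0_norm ?normc_ge0.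
  rewrite -[normc (f x)]ger0_norm ?normc_ge0// -sqrtr_sqr normc_sqr.
  apply: (cvg_comp _ Num.sqrt); last exact: sqrt_continuous.
  apply: cvgD; rewrite expr2; under eq_fun do rewrite expr2; apply: cvgM.
  - exact: cf1.
  - exact: cf1.
  - exact: cf2.
  - exact: cf2.
have nL : \forall y \near x, (L < (normc (f y))%:E)%E.
  move: Lf; case: L => [r| |]//.
    rewrite lte_fin => rf.
    have near_gt : \forall y \near x, r < normc (f y) := cvgr_gt _ cn _ rf.
    by near=> y; rewrite lte_fin; near: y; exact: near_gt.
  by move=> _; near=> y; rewrite ltNyr.
have := ess_sup_inf.ess_sup_ge mu (abse \o (fun y => (normc (f y))%:E)); rewrite -/L.
move=> [N [mN N0 subN]].
have [e /= e0 be] := nL.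
have sub : `](x - e), (x + e)[%classic `<=` N.
  move=> y /=; rewrite in_itv/= => /andP[ye1 ye2]; apply: subN => /=.
  rewrite ger0_norm ?normc_ge0// => h.
  have /be/= : ball x e y by rewrite /ball/= ltr_norml; apply/andP; split; lra.
  by rewrite ltNge h.
have : (mu `](x - e)%R, (x + e)%R[%classic <= mu N)%E.
  by apply: le_measure => //; rewrite inE.
have xe : x - e < x + e by lra.
rewrite N0 lebesgue_measure_itv/= lte_fin xe -EFinD lee_fin => h.
by move: h e0; clear; lra.
Unshelve. all: end_near. Qed.

Lemma soliton_blowupLoo al : 0 < al ->
  cLnorm +oo%E (soliton al t) @[t --> (pi / (3 * al ^+ 2))^'-] --> +oo%E.
Proof.
move=> al0; have [S _ _] := soliton_is_solution al0.
have T0 : 0 < pi / (3 * al ^+ 2) by rewrite divr_gt0 ?pi_gt0// mulr_gt0 ?exprn_gt0.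
apply/cvgeyPge => A; near=> t.
have t_ge0 : 0 <= t by near: t; exact: nbhs_left_ge.
have tT : t < pi / (3 * al ^+ 2) by near: t; exact: nbhs_left_lt.
have [|_ ct] := S t; first by rewrite t_ge0.
apply: le_trans (cLnormy_ge 0 ct); rewrite lee_fin; near: t.
by have /cvgryPge := soliton_blowup al0; apply.
Unshelve. all: end_near. Qed.

Lemma soliton_initial_family : exists D : nat -> R -> R -> C,
  D 0%N = soliton_atom 1 0 0 1 1 (1 ^+ 2) /\
  forall j, (forall x, cder (D j 0) x (D j.+1 0 x)) /\ exists M, decay M (D j 0).
Proof.
(* All data are dilations of the profile with [al = 1]; pi/6 is one time below its blow-up time
   pi/3. *)
have t0pi : 3 * 1 ^+ 2 * (pi / 6) < pi :> R by rewrite expr1n mulr1; have := pi_gt0 R; lra.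
have t00 : 0 < pi / 6 :> R by rewrite divr_gt0 ?pi_gt0.
have SK := schwartz_soliton_family ltr01 t00 t0pi.
have zab : - (pi / 6) < (0 : R) < pi / 6 by rewrite oppr_lt0 t00.
have next (f : {f | soliton_family (1 : R) f}) : {g : {f | soliton_family (1 : R) f} |
    forall x, cder (sval f 0) x (sval g 0 x)}.
  case: f => f Kf; have /cid2[g Kg fg] := schwartz_d_space SK Kf.
  by exists (exist _ g Kg) => x /=; exact: fg.
have K0 : soliton_family (1 : R) (soliton_atom 1 0 0 1 1 (1 ^+ 2)) by exact: SolitonAtom.
exists (fun j => sval (iter j (fun f => sval (next f)) (exist _ _ K0))); split => // j; split.
  by move=> x /=; exact: (svalP (next _)).
case: (iter j _ _) => f /= Kf; have [M fM] := schwartz_decay SK Kf.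
by exists M; exact: fM.
Qed.

(** The initial datum is 3 sqrt(2) al times a fixed profile at al x. Its j-th derivative carries
    al^{j+1} and the dilation costs al^{-1/2} in L^2, so the norm is of order al^{j+1/2}, at most
    al^{1/2} because al < 1. *)
Lemma soliton_initial_Hnorm k : exists2 c : R, 0 < c & forall al : R, 0 < al < 1 ->
  (Hnorm k (soliton al 0%R) <= (c * Num.sqrt al)%:E)%E.
Proof.
have [D [D0 dD]] := soliton_initial_family.
have [M DM] : {M : nat -> R | forall j, decay (M j) (D j 0)}.
  by have /choice[M DM] := fun j => (dD j).2; apply: cid; exists M.
have M0 j : 0 <= M j by exact: decay_ge0 (DM j).
pose B j : R := 3 * Num.sqrt 2 * M j * Num.sqrt pi.
have B0 j : 0 <= B j by rewrite !mulr_ge0 ?sqrtr_ge0.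
(* The 1 makes the constant positive: the [B j] are only known to be nonnegative. *)
exists (\sum_(j < k.+1) B j + 1); first by rewrite ltr_wpDl ?sumr_ge0.
move=> al /andP[al0 al1].
pose E j x : C := (soliton_amplitude al * al ^+ j)%:C%C * D j 0 (al * x).
have amp0 : 0 <= soliton_amplitude al by rewrite !mulr_ge0 ?sqrtr_ge0 ?(ltW al0).
have dE j x : cder (E j) x (E j.+1 x).
  have h : cder (fun y => D j 0 (al * y)) x (al%:C%C * D j.+1 0 (al * x)).
    have [d1 d2] := (dD j).1 (al * x).
    have hx : is_derive x 1 (fun y => al * y) al.
      by apply: is_derive_eq; rewrite /GRing.scale/= mulr1.
    split.
      have := is_derive1_comp d1 hx.
      by move=> h; apply: is_derive_eq h _; rewrite Re_mul/= mul0r subr0 mulrC.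
    have := is_derive1_comp d2 hx.
    by move=> h; apply: is_derive_eq h _; rewrite Im_mul/= mul0r addr0 mulrC.
  apply: cder_eq (cderZ _ h) _.
  by rewrite /E !real_complexM !real_complexX exprS; ring.
have cE j : ccontinuous (E j) by exact: cder_continuous (dE j).
have mE j := ccontinuous_measurable (cE j).
have EB j x : normc (E j x) ^+ 2 <=
    (soliton_amplitude al * al ^+ j * M j) ^+ 2 * (oneDsqr (al * x))^-1.
  rewrite /E Normc.normcM normc_real ger0_norm ?mulr_ge0 ?exprn_ge0 ?(ltW al0)//.
  move: (soliton_amplitude al * al ^+ j) => A; rewrite !exprMn -[leRHS]mulrA.
  by apply: ler_wpM2l; [exact: sqr_ge0|exact: (decay_sqr_le (al * x) (DM j))].
have LE j : (cLnorm 2%:E (E j) <= (B j * Num.sqrt al)%:E)%E.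
  have h := cLnorm2_le (_ : 0 <= soliton_amplitude al * al ^+ j * M j) al0 (mE j) (EB j).
  apply: le_trans (h _) _; first by rewrite !mulr_ge0 ?exprn_ge0 ?(ltW al0).
  have sal : Num.sqrt al != 0 by rewrite gt_eqF ?sqrtr_gt0.
  rewrite lee_fin sqrtrM ?pi_ge0// sqrtrV ?(ltW al0)// /soliton_amplitude /B.
  have ale : al = Num.sqrt al * Num.sqrt al by rewrite -expr2 sqr_sqrtr ?(ltW al0).
  rewrite [leLHS](_ : _ = 3 * Num.sqrt 2 * M j * Num.sqrt pi * Num.sqrt al * al ^+ j).
    rewrite -[leRHS]mulr1 ler_wpM2l ?exprn_ile1 ?(ltW al0) ?(ltW al1)//.
    by rewrite !mulr_ge0 ?sqrtr_ge0.
  by rewrite {1}ale; field.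
apply: le_trans.
  apply: (@Hnorm_le R k _ E (fun j => B j * Num.sqrt al)) => //.
  - apply/funext => x; rewrite /E D0 /soliton expr0 mulr1 /soliton_atom /soliton_denom.
    by rewrite !mulr0 mul1r.
  - move=> j _; split; first exact: mE.
    exact: le_lt_trans (LE j) (ltry _).
  - by move=> j; rewrite mulr_ge0 ?sqrtr_ge0.
by rewrite -mulr_suml lee_fin ler_wpM2r ?sqrtr_ge0// lerDl.
Qed.

End SolitonSolution.

Theorem theorem2 (R : realType) :
  exists u : R -> R -> R -> R[i],
    [/\ forall alpha : R, 0 < alpha < 1 ->
          is_solution (pi / (3 * alpha ^+ 2)) (u alpha),
        forall alpha : R, 0 < alpha < 1 ->
          cLnorm +oo%E (u alpha t)
            @[t --> (pi / (3 * alpha ^+ 2))^'-] --> +oo%E /\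
          Normc.normc (u alpha t 0)
            @[t --> (pi / (3 * alpha ^+ 2))^'-] --> +oo &
        forall k : nat, exists2 C : R, 0 < C &
          forall alpha : R, 0 < alpha < 1 ->
            (Hnorm k (u alpha 0%R) <= (C * Num.sqrt alpha)%:E)%E].
Proof.
exists soliton; split.
- by move=> al /andP[al0 _]; exact: soliton_is_solution.
- move=> al /andP[al0 _]; split; first exact: soliton_blowupLoo.
  exact: soliton_blowup.
- exact: soliton_initial_Hnorm.
Qed.
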